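(* There is a constant $C>0$ depending only on $\sigma$ and $d$ such that, in the recovering bandits model, the $d$-step single play lookahead Bayesian regret of $d$RGP-TS satisfies $$\mathbb E[\mathrm{Reg}_T^{(d,s)}]\le C\sqrt{KT\gamma_T\log(TK|\mathcal Z|)}.$$
   Context: Recovering bandits model: $K$ arms, horizon $T$, $\mathcal Z=\{0,\dots,z_{\max}\}$, $T\ge K|\mathcal Z|$. The recovery functions $f_1,\dots,f_K:\mathcal Z\to\mathbb R$ are drawn independently from a zero-mean Gaussian process with known kernel $k$ satisfying $k(z,z)\le1$. The state at round $t$ is $\mathbf Z_t=(Z_{1,t},\dots,Z_{K,t})\in\mathcal Z^K$ (given initial state); if arm $J_t$ is played then $Z_{j,t+1}=0$ for $j=J_t$ and $Z_{j,t+1}=\min\{z_{\max},Z_{j,t}+1\}$ otherwise, and one observes $Y_t=f_{J_t}(Z_{J_t,t})+\epsilon_t$ with $\epsilon_t$ i.i.d. $\mathcal N(0,\sigma^2)$, $\sigma$ known. Each arm's posterior is the standard GP posterior given that arm's past observations. Lookahead tree: from a root state $\mathbf Z$, a leaf $i$ is a sequence of arms $(j_0,\dots,j_{d-1})$ (single play: pairwise distinct arms, $d\le K$; multiple play: arbitrary in $\{1,\dots,K\}^d$); along it, states are updated by the rule above, giving $z$-values $z_\ell$ of arm $j_\ell$ at step $\ell$. $M_i(\mathbf Z)=\sum_{\ell=0}^{d-1}f_{j_\ell}(z_\ell)$ and $M^*(\mathbf Z)=\max_iM_i(\mathbf Z)$ over the leaves of the relevant tree. $d$RGP-TS: at each round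 $t\in\{1,d+1,2d+1,\dots\}$, $t<T$, for every arm $j$ draw a sample $\tilde f_j$ from the current posterior of $f_j$ (jointly at all $z$-values reachable in the lookahead), set $\tilde\eta_t(i)=\sum_{\ell}\tilde f_{j_\ell}(z_\ell)$ for each leaf $i$ of the tree rooted at $\mathbf Z_t$, choose $I_t\in\arg\max_i\tilde\eta_t(i)$, play the $d$ arms of $I_t$ in rounds $t,\dots,t+d-1$, then update the posteriors. $d$-step lookahead regret: $\mathbb E[\mathrm{Reg}_T^{(d)}]=\sum_{h=0}^{\lfloor T/d\rfloor}\mathbb E[M^*(\mathbf Z_{hd+1})-M_{I_{hd+1}}(\mathbf Z_{hd+1})]$, expectation over the $f_j$, noise and algorithm; $\mathrm{Reg}^{(d,s)}$ (resp. $\mathrm{Reg}^{(d,m)}$) uses single (resp. multiple) play trees. Maximal information gain: $\gamma_N=\max_{z_1,\dots,z_N\in\mathcal Z}\frac12\log\det(I_N+\sigma^{-2}[k(z_a,z_b)]_{a,b=1}^N)$. *)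

(* Defs.v *)
From HB Require Import structures.
From mathcomp Require Import all_boot all_order all_algebra.
From mathcomp Require Import all_classical all_reals all_analysis.
Set Implicit Arguments.
Unset Strict Implicit.
Unset Printing Implicit Defensive.
Import Order.TTheory GRing.Theory Num.Theory.

Local Open Scope ring_scope.

(* Expectation w.r.t. n i.i.d. standard Gaussian coordinates           *)
(* (iterated integrals against N(0,1); for nonnegative measurable      *)
(*  integrands this is the integral w.r.t. the n-fold product measure). *)
Fixpoint gauss_expect {R : realType} (n : nat) (g : seq R -> \bar R) : \bar R :=
  match n with
  | 0 => g [::]
  | n'.+1 => (\int[normal_prob (0:R) 1]_x gauss_expect n' (fun w => g (x :: w)))%E
  end.

Definition psd {R : realType} n (S : 'M[R]_n) : Prop :=
  S^T = S /\ forall v : 'rV[R]_n, 0 <= (v *m S *m v^T) 0 0.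

Section Model.
Variables (R : realType) (sigma : R) (d K zmax T : nat).
Variable k : 'I_zmax.+1 -> 'I_zmax.+1 -> R.
Variable s0 : {ffun 'I_K -> 'I_zmax.+1}.
Variable msqrt : forall n, 'M[R]_n -> 'M[R]_n.

Local Notation NZ := zmax.+1.
Local Notation Z := 'I_zmax.+1.
Local Notation state := {ffun 'I_K -> 'I_zmax.+1}.

Definition Kmat : 'M[R]_NZ := \matrix_(z, z') k z z'.

Definition step (s : state) (j : 'I_K) : state :=
  [ffun j' => if j' == j then ord0 else inord (minn zmax (s j').+1)].

Fixpoint leaf_val (g : 'I_K -> Z -> R) (s : state) (l : seq 'I_K) : R :=
  match l with
  | [::] => 0
  | j :: l' => g j (s j) + leaf_val g (step s j) l'
  end.

(* single-play lookahead tree of depth d: pairwise distinct arm sequences *)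
Definition leaves : seq (seq 'I_K) :=
  map val (enum [pred t : d.-tuple 'I_K | uniq t]).

Definition Mstar (g : 'I_K -> Z -> R) (s : state) : \bar R :=
  \big[Order.max/-oo%E]_(i <- leaves) (leaf_val g s i)%:E.

Definition pick_leaf (g : 'I_K -> Z -> R) (s : state) : seq 'I_K :=
  head [::] [seq i <- leaves | all (fun i' => leaf_val g s i' <= leaf_val g s i) leaves].

Section Posterior.
Variable obs : seq (Z * R).
Let m := size obs.
Let zo (a : 'I_m) : Z := (nth (ord0, 0) obs a).1.
Let yo (a : 'I_m) : R := (nth (ord0, 0) obs a).2.
Let Ginv : 'M[R]_m := invmx ((\matrix_(a, b) k (zo a) (zo b)) + (sigma ^+ 2)%:M).
Let KZX : 'M[R]_(NZ, m) := \matrix_(z, b) k z (zo b).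
Definition post_mean : 'cV[R]_NZ := KZX *m Ginv *m (\col_b yo b).
Definition post_cov : 'M[R]_NZ := Kmat - KZX *m Ginv *m KZX^T.
End Posterior.

(* number of decision rounds t = hd+1, h = 0, ..., floor(T/d) *)
Definition H := (T %/ d).+1.

(* layout of the standard Gaussian seed w *)
Definition prior_idx (j : 'I_K) (z : Z) : nat := j * NZ + z.
Definition noise_idx (r : nat) : nat := K * NZ + r.
Definition ts_idx (h : nat) (j : 'I_K) (z : Z) : nat := K * NZ + H * d + (h * K + j) * NZ + z.
Definition seed_size : nat := K * NZ + H * d + H * K * NZ.

Section Run.
Variable w : seq R.

(* true recovery functions f_j = L xi_j with L L^T = Kmat *)
Definition ftrue (j : 'I_K) (z : Z) : R :=
  \sum_(z' < NZ) msqrt Kmat z z' * nth 0 w (prior_idx j z').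

Definition ts_sample (h : nat) (hist : 'I_K -> seq (Z * R)) (j : 'I_K) (z : Z) : R :=
  post_mean (hist j) z 0 +
  \sum_(z' < NZ) msqrt (post_cov (hist j)) z z' * nth 0 w (ts_idx h j z').

(* play the arms of a leaf in consecutive rounds (r = 0-based round index) *)
Fixpoint play (s : state) (hist : 'I_K -> seq (Z * R)) (l : seq 'I_K) (r : nat)
  : state * ('I_K -> seq (Z * R)) :=
  match l with
  | [::] => (s, hist)
  | j :: l' =>
      let y := ftrue j (s j) + sigma * nth 0 w (noise_idx r) in
      play (step s j)
           (fun j' => if j' == j then rcons (hist j') (s j, y) else hist j')
           l' r.+1
  end.

Fixpoint run (n h : nat) (s : state) (hist : 'I_K -> seq (Z * R)) : \bar R :=
  match n with
  | 0 => 0%E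
  | n'.+1 =>
      let I := pick_leaf (ts_sample h hist) s in
      let term := (Mstar ftrue s - (leaf_val ftrue s I)%:E)%E in
      let p := play s hist I (h * d) in
      (term + run n' h.+1 p.1 p.2)%E
  end.

Definition regret : \bar R := run H 0 s0 (fun _ => [::]).
End Run.

Definition expected_regret : \bar R := gauss_expect seed_size regret.

End Model.

Definition gammaN {R : realType} (sigma : R) (zmax : nat)
  (k : 'I_zmax.+1 -> 'I_zmax.+1 -> R) (N : nat) : R :=
  \big[Num.max/0]_(zs : {ffun 'I_N -> 'I_zmax.+1})
     (2^-1 * ln (\det (1%:M + sigma^-2 *: \matrix_(a, b) k (zs a) (zs b)))).

Definition kernel_ok {R : realType} (zmax : nat) (k : 'I_zmax.+1 -> 'I_zmax.+1 -> R) :=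
  psd (\matrix_(z, z') k z z') /\ forall z, k z z <= 1.

Arguments expected_regret {R} sigma d K zmax T k s0 msqrt.

(* Main.v *)
(* Thompson sampling analysed through exact conditional laws.  Conditionally on the history
   at the start of a round, the true functions f and the drawn functions g have the same law
   and the leaf I chosen from g is independent of f.  Hence E[max f] = E[g(I)] and
   E[f(I)] = E[mu(I)], where mu is the posterior mean, and the regret of the round is
   E[(g - mu)(I)].  By AM-GM, (g - mu)(I) is at most c/2 times the sum of the posterior
   variances along I plus d/(2c) times the maximum of K|Z| squared standard normal variables,
   whose expectation is O(log K|Z|).  In a single play leaf no arm is observed twice, so the
   variances along I are exactly those appearing in the chain rule
   1/2 log det(I + K/sigma^2) = sum 1/2 log(1 + variance/sigma^2), and they add up to
   O(K gamma_T) over all rounds, for every trajectory.  Optimising c gives the theorem.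
   The conditional law of f is handled by induction on the rounds: a centred Gaussian vector
   is determined by its Gram matrix, so that the pair (f_j, observation) can be replaced by
   (new posterior draw of f_j, innovation) under the integral sign. *)
Require Import Defs.
From HB Require Import structures.
From mathcomp Require Import all_boot all_order all_algebra.
From mathcomp Require Import all_classical all_reals all_analysis.
From mathcomp Require Import measurable_realfun ring lra zify.
Set Implicit Arguments.
Unset Strict Implicit.
Unset Printing Implicit Defensive.
Import Order.TTheory GRing.Theory Num.Theory.
Local Open Scope classical_set_scope.
Local Open Scope ring_scope.

(** * Elementary facts *)

(** The expectation is an iterated integral over a seed, so conditioning means choosing an order of
    integration: the coordinates left outside are frozen, and Tonelli's theorem and rotation
    invariance rearrange the others. Both are used for nonnegative integrands only, which is why
    identities between expectations are written with sums instead of differences and with shifts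
    that keep every term nonnegative. The square root [msqrt] is arbitrary and may vary with the
    history without any regularity. Posterior draws can therefore be compared only through their
    covariances, and measurability rests on the observed points being constant along a fixed leaf.
    The variances are paid by a potential, the information that the arms may still gain. Its drop at
    a play bounds the variance of that play for every history, so random numbers of plays never have
    to be estimated. One value of [c] serves all rounds. The logarithm also has to absorb the
    additive constant in the expected maximum, which is impossible when [T * K * zmax.+1 = 1]; the
    tree then has a single leaf and the regret is zero. *)

Lemma argmax_seq (R : realType) (T : eqType) (r : seq T) (f : T -> R) : r != [::] ->
  exists2 x, x \in r & all (fun y => f y <= f x) r.
Proof.
elim: r => // y r IH _; have [->|/IH [x xr /allP fx]] := eqVneq r [::].
  by exists y; rewrite ?mem_head//= lexx.
have [yx|xy] := leP (f y) (f x).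
  by exists x; [rewrite inE xr orbT|rewrite /= yx; apply/allP].
exists y; first exact: mem_head.
by rewrite /= lexx; apply/allP => t /fx /le_trans; apply; exact: ltW.
Qed.

Lemma perm_sub (A : eqType) (s b : seq A) : uniq s -> uniq b -> {subset b <= s} ->
  perm_eq s ([seq i <- s | i \notin b] ++ b).
Proof.
move=> us ub bs; apply: uniq_perm => // [|i].
  rewrite cat_uniq filter_uniq//= ub andbT; apply/hasPn => i ib.
  by rewrite mem_filter ib.
rewrite mem_cat mem_filter; have [ib|ib] := boolP (i \in b); last by rewrite orbF.
by rewrite orbT bs.
Qed.

Lemma ereal_half_eq (R : realDomainType) (x y : \bar R) : (0 <= x)%E -> (0 <= y)%E ->
  (x + x = y + y)%E -> x = y.
Proof.
by move: x y => [x||] [y||] // _ _ []// e; congr EFin; lra.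
Qed.

(** The right side is minimal at [c = sqrt (B / A)]. For [A = 0] there is no minimiser, and the
    infimum 0 is approached by letting [c = B / e] grow. *)
Lemma le_inf_balance (R : realType) (x : \bar R) (A B : R) : 0 <= A -> 0 < B ->
  (forall c, 0 < c -> (x <= (c * A + B / c)%:E)%E) -> (x <= (2 * Num.sqrt (A * B))%:E)%E.
Proof.
move=> A0 B0 h; have [A00|A1] := eqVneq A 0.
  rewrite A00 mul0r sqrtr0 mulr0; apply/lee_addgt0Pr => e e0; rewrite add0e.
  apply: le_trans (h (B / e) _) _; first by rewrite divr_gt0.
  by rewrite lee_fin A00 mulr0 add0r invf_div mulrCA divff ?gt_eqF// mulr1.
have Ap : 0 < A by rewrite lt_neqAle eq_sym A1.
have sA : 0 < Num.sqrt A by rewrite sqrtr_gt0.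
have sB : 0 < Num.sqrt B by rewrite sqrtr_gt0.
apply: le_trans (h (Num.sqrt B / Num.sqrt A) _) _; first by rewrite divr_gt0.
rewrite lee_fin sqrtrM//; move: sA sB (sqr_sqrtr A0) (sqr_sqrtr (ltW B0)).
move: (Num.sqrt A) (Num.sqrt B) => a b a0 b0 <- <-.
have -> : b / a * a ^+ 2 + b ^+ 2 / (b / a) = 2 * (a * b) by field; rewrite !gt_eqF.
exact: lexx.
Qed.

(** * The standard normal distribution *)

Section density.
Local Open Scope ereal_scope.
Context d (T : measurableType d) (R : realType).
Variables (mu nu : {measure set T -> \bar R}) (p : T -> R).
Hypothesis mp : measurable_fun setT p.
Hypothesis p0 : forall x, (0 <= p x)%R.
Hypothesis nuE : forall A, measurable A -> nu A = \int[mu]_(x in A) (p x)%:E.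

Let indic_density E : measurable E ->
  \int[nu]_x (\1_E x)%:E = \int[mu]_x ((p x)%:E * (\1_E x)%:E).
Proof.
move=> mE; rewrite integral_indic//= setIT nuE// integral_mkcond/=.
apply: eq_integral => x _; rewrite patchE indicE; case: ifPn => xE.
  by rewrite mule1.
by rewrite mule0.
Qed.

Import HBNNSimple.

Let nnsfun_density (f : {nnsfun T >-> R}) :
  \int[nu]_x (f x)%:E = \int[mu]_x ((p x)%:E * (f x)%:E).
Proof.
under [LHS]eq_integral do rewrite fimfunE -fsumEFin//.
rewrite [LHS]ge0_integral_fsum//; last 2 first.
  - by move=> r; exact/measurable_EFinP/measurableT_comp.
  - by move=> n x _; rewrite EFinM nnfun_muleindic_ge0.
under [RHS]eq_integral.
  move=> x xD; rewrite fimfunE -fsumEFin// ge0_mule_fsumr; last first.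
    by move=> r; rewrite EFinM nnfun_muleindic_ge0.
  over.
rewrite [RHS]ge0_integral_fsum//; last 2 first.
  - move=> r; apply: emeasurable_funM; first exact/measurable_EFinP.
    by apply/measurable_EFinP; apply/measurableT_comp => //.
  - move=> n x _; apply: mule_ge0; first by rewrite lee_fin.
    by rewrite EFinM nnfun_muleindic_ge0.
apply: eq_fsbigr => r; rewrite inE => -[t _ <-].
have mf : measurable (f @^-1` [set f t]) by [].
have ft0 : 0 <= (f t)%:E by rewrite lee_fin; exact: fun_ge0.
under eq_integral do rewrite EFinM.
under [RHS]eq_integral do rewrite EFinM muleCA.
rewrite !ge0_integralZl//.
- by rewrite indic_density.
- apply: emeasurable_funM; first exact/measurable_EFinP.
  by apply/measurable_EFinP; exact: measurable_indic.
- by move=> x _; rewrite mule_ge0// lee_fin.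
- by apply/measurable_EFinP; exact: measurable_indic.
Qed.

(** Indicators are the hypothesis on [nu], simple functions follow by linearity, and monotone
    convergence gives the rest. *)
Lemma ge0_integral_density (f : T -> \bar R) :
  measurable_fun setT f -> (forall x, 0 <= f x) ->
  \int[nu]_x f x = \int[mu]_x ((p x)%:E * f x).
Proof.
move=> mf f0.
pose f_ := nnsfun_approx measurableT mf.
transitivity (lim (\int[nu]_x (f_ n x)%:E @[n --> \oo])).
  rewrite -monotone_convergence//=.
  - apply: eq_integral => ? /[!inE] xD; apply/esym/cvg_lim => //=.
    exact: cvg_nnsfun_approx.
  - by move=> n; exact/measurable_EFinP/measurable_funTS.
  - by move=> n ? _; rewrite lee_fin.
  - by move=> ? _ ? ? mn; rewrite lee_fin; exact/lefP/nd_nnsfun_approx.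
transitivity (lim (\int[mu]_x ((p x)%:E * (f_ n x)%:E) @[n --> \oo])).
  by apply: congr_lim; apply/funext => n /=; exact: nnsfun_density.
rewrite -monotone_convergence//=.
- apply: eq_integral => x _; apply/cvg_lim => //.
  by apply: cvgeZl => //; exact: cvg_nnsfun_approx.
- move=> n; apply: emeasurable_funM; first exact/measurable_EFinP.
  exact/measurable_EFinP/measurable_funTS.
- by move=> n ? _; rewrite mule_ge0// lee_fin.
- move=> ? _ ? ? mn; apply: lee_wpmul2l; first by rewrite lee_fin.
  by rewrite lee_fin; exact/lefP/nd_nnsfun_approx.
Qed.

End density.

(** * Affine changes of variable for Lebesgue measure *)

Section lebesgue_affine.
Local Open Scope ereal_scope.
Context {R : realType}.
Local Notation mu := (@lebesgue_measure R).

Let aff (a b : R) : measurableTypeR R -> measurableTypeR R := fun x => (a * x + b)%R.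

Let maff a b : measurable_fun setT (aff a b).
Proof. by apply: measurable_funD => //; exact: measurable_funM. Qed.

HB.instance Definition _ a b := isMeasurableFun.Build _ _ _ _ _ (maff a b).

(** The rescaled pushforward gives each half-open interval its length, which characterises Lebesgue
    measure. *)
Lemma lebesgue_measure_affine (a b : R) (A : set (measurableTypeR R)) : (0 < a)%R ->
  measurable A ->
  a%:E * pushforward mu (aff a b) A = mu A.
Proof.
move=> a0 mA; pose na := NngNum (ltW a0).
apply/esym; apply: (@lebesgue_measure_unique R
  (mscale na (pushforward mu (aff a b)))) => //= _ [[u v]] _ <-.
rewrite /mscale/= /pushforward.
rewrite (_ : _ @^-1` _ = `]((u - b) / a)%R, ((v - b) / a)%R]%classic); last first.
  apply/seteqP; split => x; rewrite /= !in_itv/= ltr_pdivrMr// ler_pdivlMr//.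
    by rewrite /aff mulrC ltrBlDr lerBrDr mulrC.
  by rewrite /aff [(x * a)%R]mulrC ltrBlDr lerBrDr.
rewrite !lebesgue_measure_itv/= !lte_fin ltr_pM2r ?invr_gt0// ltrD2r.
case: ifP => _; last by rewrite mule0.
rewrite -!EFinB -EFinM -mulrBl mulrCA divff ?gt_eqF// mulr1; congr EFin; ring.
Qed.

Lemma ge0_integral_affine (a b : R) (f : R -> \bar R) : a != 0%R ->
  measurable_fun setT f -> (forall x, 0 <= f x) ->
  `|a|%:E * \int[mu]_x f (a * x + b)%R = \int[mu]_x f x.
Proof.
have pos (c e : R) (g : R -> \bar R) : (0 < c)%R -> measurable_fun setT g ->
    (forall x, 0 <= g x) ->
    c%:E * \int[mu]_x g (c * x + e)%R = \int[mu]_x g x.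
  move=> c0 mg g0; pose nc := NngNum (ltW c0).
  have := @ge0_integral_pushforward _ _ _ _ R _ (maff c e) mu setT g measurableT mg.
  rewrite preimage_setT /= => <-; last by move=> y _; exact: g0.
  rewrite -(@ge0_integral_mscale _ _ _ _ setT measurableT nc)//=.
  by apply: eq_measure_integral => A mA _; exact: lebesgue_measure_affine.
have opp (g : R -> \bar R) : measurable_fun setT g -> (forall x, 0 <= g x) ->
    \int[mu]_x g (- x)%R = \int[mu]_x g x.
  move=> mg g0.
  have := @ge0_integral_pushforward _ _ _ _ R
    (-%R : measurableTypeR R -> measurableTypeR R) (@oppr_measurable _ _) mu setT g measurableT mg.
  rewrite preimage_setT /= => <-; last by move=> y _; exact: g0.
  by apply: eq_measure_integral => A mA _; exact: (lebesgue_measureN mA).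
move=> a0 mf f0; have [ap|an|/eqP] := ltgtP a 0%R; last by rewrite (negbTE a0).
- rewrite ltr0_norm// -[RHS]opp//.
  rewrite -(pos (- a)%R (- b)%R (fun x => f (- x)%R)) ?oppr_gt0//; last 1 first.
    by apply: measurableT_comp.
  by congr (_ * _); apply: eq_integral => x _; congr f; ring.
- by rewrite gtr0_norm// pos.
Qed.

End lebesgue_affine.

(** * Rotation invariance of the planar standard normal law *)

Section std_normal.
Local Open Scope ereal_scope.
Context {R : realType}.
Local Notation mu := (@lebesgue_measure R).
Local Notation N := (@normal_prob R 0%R 1%R).
Local Notation p := (@normal_pdf R 0%R 1%R).

Lemma std_normal_pdfE x : p x = (normal_peak 1 * expR (- (x ^+ 2 / 2)))%R.
Proof.
rewrite normal_pdfE ?oner_neq0// /normal_fun subr0 expr1n mulNr.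
by rewrite -(mulr_natr 1%R 2) mul1r.
Qed.

Lemma std_normal_pdfM x y u v : (x ^+ 2 + y ^+ 2 = u ^+ 2 + v ^+ 2)%R ->
  (p x * p y = p u * p v)%R.
Proof.
move=> e; rewrite !std_normal_pdfE mulrACA [RHS]mulrACA -!expRD; congr (_ * expR _)%R.
by rewrite -!opprD -!mulrDl e.
Qed.

Lemma ge0_integral_std_normal (f : R -> \bar R) :
  measurable_fun setT f -> (forall x, 0 <= f x) ->
  \int[N]_x f x = \int[mu]_x ((p x)%:E * f x).
Proof.
move=> mf f0.
apply: (@ge0_integral_density _ _ _ mu N p) => //; first exact: measurable_normal_pdf.
by move=> x; exact: normal_pdf_ge0.
Qed.

Lemma ge0_integral_std_normalN (f : R -> \bar R) :
  measurable_fun setT f -> (forall x, 0 <= f x) ->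
  \int[N]_x f (- x)%R = \int[N]_x f x.
Proof.
move=> mf f0.
have mfN : measurable_fun setT (fun x : R => f (- x)%R) by exact: measurableT_comp.
rewrite !ge0_integral_std_normal//.
rewrite -[RHS](@ge0_integral_affine R (-1)%R 0%R); last 3 first.
- by rewrite oppr_eq0 oner_neq0.
- apply: emeasurable_funM => //; apply/measurable_EFinP.
  exact: measurable_normal_pdf.
- by move=> x; rewrite mule_ge0// lee_fin normal_pdf_ge0.
rewrite normrN1 mul1e; apply: eq_integral => x _.
by rewrite addr0 mulN1r !std_normal_pdfE sqrrN.
Qed.

(** The rotation is split into two one-dimensional affine substitutions around a Tonelli exchange:
    [u = c * x + s * y] at fixed [x], then [v = (c * u - x) / s] at fixed [u]. Their Jacobians
    [1 / |s|] and [|s|] cancel. *)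
Lemma lebesgue_rot (P : R * R -> \bar R) (c s : R) : s != 0%R ->
  (c ^+ 2 + s ^+ 2 = 1)%R ->
  measurable_fun setT P -> (forall x, 0 <= P x) ->
  \int[mu]_x \int[mu]_y P (c * x + s * y, - s * x + c * y)%R =
  \int[mu]_x \int[mu]_y P (x, y).
Proof.
move=> s0 cs mP P0.
pose q (z : R * R) : R * R := (z.2, (c * z.2 - z.1) / s)%R.
have mq : measurable_fun setT q.
  apply/measurable_fun_pair; first exact: measurable_snd.
  apply: measurable_funM => //; apply: measurable_funB => //.
  exact: measurable_funM.
have mQ : measurable_fun setT (P \o q) by exact: measurableT_comp mP mq.
have Q0 z : 0 <= (P \o q) z by exact: P0.
have mQx x : measurable_fun setT (fun y => (P \o q) (x, y)).
  by apply: measurableT_comp mQ _.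
transitivity (\int[mu]_x (`|s|^-1%:E * \int[mu]_u (P \o q) (x, u))).
  apply: eq_integral => x _.
  rewrite -(@ge0_integral_affine R s (c * x)%R _ s0 (mQx x) (fun=> Q0 _)).
  rewrite muleA -EFinM mulVf ?normr_eq0// mul1e.
  apply: eq_integral => y _; rewrite /q/=.
  have -> : (s * y + c * x = c * x + s * y)%R by ring.
  congr (P (_, _)); apply: (mulIf s0); rewrite divfK//.
  rewrite -[in X in (_ - X)%R](mul1r x) -cs; ring.
have mF : measurable_fun setT (fun x => \int[mu]_u (P \o q) (x, u)).
  exact: (@measurable_fun_fubini_tonelli_F _ _ _ _ R mu _ mQ Q0).
have mG : measurable_fun setT (fun u => \int[mu]_x (P \o q) (x, u)).
  exact: (@measurable_fun_fubini_tonelli_G _ _ _ _ R mu _ mQ Q0).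
have s0' : 0 <= (`|s|^-1%:E : \bar R) by rewrite lee_fin invr_ge0.
rewrite (@ge0_integralZl _ _ _ mu _ measurableT _ mF _ _ s0'); last first.
  by move=> x _; exact: integral_ge0.
rewrite (@fubini_tonelli _ _ _ _ R mu mu _ mQ Q0).
rewrite -(@ge0_integralZl _ _ _ mu _ measurableT _ mG _ _ s0'); last first.
  by move=> x _; exact: integral_ge0.
apply: eq_integral => u _.
have mPu : measurable_fun setT (fun y => P (u, y)) by apply: measurableT_comp mP _.
rewrite -(@ge0_integral_affine R (- s^-1)%R (c / s * u)%R _ _ mPu (fun=> P0 _)); last first.
  by rewrite oppr_eq0 invr_eq0.
rewrite normrN normfV; congr (_ * _); apply: eq_integral => x _.
by rewrite /q/=; congr (P (_, _)); field.
Qed.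

Lemma ge0_integral_std_normal2 (h : R * R -> \bar R) :
  measurable_fun setT h -> (forall x, 0 <= h x) ->
  \int[N]_x \int[N]_y h (x, y) =
  \int[mu]_x \int[mu]_y ((p x * p y)%:E * h (x, y)).
Proof.
move=> mh h0; rewrite ge0_integral_std_normal; last 2 first.
- exact: (@measurable_fun_fubini_tonelli_F _ _ _ _ R N h mh h0).
- by move=> x; exact: integral_ge0.
apply: eq_integral => x _.
have mhx : measurable_fun setT (fun y => h (x, y)) by apply: measurableT_comp mh _.
have px : 0 <= (p x)%:E by rewrite lee_fin normal_pdf_ge0.
rewrite (ge0_integral_std_normal mhx)// -(@ge0_integralZl _ _ _ mu _ measurableT _ _ _ _ px)//.
- by apply: eq_integral => y _; rewrite EFinM muleA.
- apply: emeasurable_funM => //; apply/measurable_EFinP.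
  exact: measurable_normal_pdf.
- by move=> y _; rewrite mule_ge0// lee_fin normal_pdf_ge0.
Qed.

Lemma std_normal_rot (g : R * R -> \bar R) (c s : R) :
  (c ^+ 2 + s ^+ 2 = 1)%R ->
  measurable_fun setT g -> (forall x, 0 <= g x) ->
  \int[N]_x \int[N]_y g (c * x + s * y, - s * x + c * y)%R =
  \int[N]_x \int[N]_y g (x, y).
Proof.
move=> cs mg g0.
(* The substitutions of [lebesgue_rot] degenerate for [s = 0]; then [c] is 1 or -1, and the rotation
   is the identity or a reflection of both coordinates. *)
have [s0|s0] := eqVneq s 0%R.
  have /orP[/eqP c1|/eqP c1] : (c == 1%R) || (c == -1)%R.
    by rewrite -eqf_sqr expr1n -cs s0 expr0n addr0.
  - apply: eq_integral => x _; apply: eq_integral => y _.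
    by rewrite s0 c1 !mul0r oppr0 mul0r !mul1r addr0 add0r.
  - have mF : measurable_fun setT (fun x => \int[N]_y g (x, y)).
      exact: (@measurable_fun_fubini_tonelli_F _ _ _ _ R N g mg g0).
    have F0 x : 0 <= \int[N]_y g (x, y) by exact: integral_ge0.
    rewrite -[RHS](ge0_integral_std_normalN mF F0).
    apply: eq_integral => x _.
    have mgx : measurable_fun setT (fun y => g (- x, y)%R) by apply: measurableT_comp mg _.
    rewrite -[RHS](ge0_integral_std_normalN mgx (fun=> g0 _)).
    apply: eq_integral => y _.
    by rewrite s0 c1 !mul0r oppr0 mul0r !mulN1r addr0 add0r.
pose r (z : R * R) : R * R := (c * z.1 + s * z.2, - s * z.1 + c * z.2)%R.
have mr : measurable_fun setT r.
  by apply/measurable_fun_pair; apply: measurable_funD; apply: measurable_funM.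
have mgr : measurable_fun setT (g \o r) by exact: measurableT_comp mg mr.
pose pp (z : R * R) := (p z.1 * p z.2)%:E.
have mpp : measurable_fun setT pp.
  by apply/measurable_EFinP; apply: measurable_funM;
    (apply: measurableT_comp => //; exact: measurable_normal_pdf).
have mP : measurable_fun setT (pp \* g) by exact: emeasurable_funM.
have P0 z : 0 <= (pp \* g) z.
  by rewrite mule_ge0// lee_fin mulr_ge0// normal_pdf_ge0.
rewrite (ge0_integral_std_normal2 mg g0) (ge0_integral_std_normal2 mgr (fun=> g0 _)).
rewrite -[RHS](lebesgue_rot s0 cs mP P0).
apply: eq_integral => x _; apply: eq_integral => y _.
congr (_%:E * _); apply: std_normal_pdfM => /=.
transitivity ((c ^+ 2 + s ^+ 2) * (x ^+ 2 + y ^+ 2))%R; last by ring.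
by rewrite cs mul1r.
Qed.

End std_normal.

(** * Independent standard normal coordinates *)

Section environments.
Local Open Scope ereal_scope.
Context {R : realType}.
Local Notation env := (nat -> R).
Local Notation N := (@normal_prob R 0%R 1%R).

Definition upd (w : env) (i : nat) (x : R) : env := fun j => if j == i then x else w j.

(* Measurability for the product sigma-algebra on [nat -> R], tested on all families of
   measurable coordinates; Tonelli's theorem makes it stable under integration in one
   coordinate. *)
Definition env_measurable d' (U : measurableType d') (g : env -> U) : Prop :=
  forall d (T : measurableType d) (phi : nat -> T -> R),
    (forall i, measurable_fun setT (phi i)) ->
    measurable_fun setT (fun t => g (fun i => phi i t)).

Lemma env_measurable_comp d' (U : measurableType d') (g : env -> U) (h : env -> env) :
  (forall i, env_measurable (fun w => h w i)) -> env_measurable g ->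
  env_measurable (fun w => g (h w)).
Proof.
move=> mh mg d T phi mphi.
by apply: (mg _ _ (fun i t => h (fun j => phi j t) i)) => i; exact: mh.
Qed.

Lemma env_measurable_coord i : env_measurable (fun w => w i).
Proof. by move=> d T phi; exact. Qed.

Lemma env_measurable_cst d' (U : measurableType d') (u : U) :
  env_measurable (fun=> u).
Proof. by move=> d T phi _; exact: measurable_cst. Qed.

Lemma measurable_upd d (T : measurableType d) (phi : nat -> T -> R) i j :
  (forall i, measurable_fun setT (phi i)) ->
  measurable_fun setT (fun z : T * R => upd (fun k => phi k z.1) i z.2 j).
Proof.
move=> mphi; rewrite /upd; case: eqP => _; first exact: measurable_snd.
exact: (measurableT_comp (mphi j) measurable_fst).
Qed.

Lemma env_measurable_updl d' (U : measurableType d') (g : env -> U) i (h : env -> R) :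
  env_measurable h -> env_measurable g -> env_measurable (fun w => g (upd w i (h w))).
Proof.
move=> mh mg; apply: (env_measurable_comp (h := fun w => upd w i (h w))) => // j.
by rewrite /upd; case: eqP => _ //; exact: env_measurable_coord.
Qed.

Lemma measurable_section (g : env -> \bar R) w i : env_measurable g ->
  measurable_fun setT (fun x : R => g (upd w i x)).
Proof.
move=> mg; apply: (mg _ R (fun j x => upd w i x j)) => j; rewrite /upd.
by case: eqP => _; [exact: measurable_id|exact: measurable_cst].
Qed.

Lemma measurable_section2 (g : env -> \bar R) w i k : env_measurable g ->
  measurable_fun setT (fun z : R * R => g (upd (upd w i z.1) k z.2)).
Proof.
move=> mg; apply: (mg _ _ (fun j z => upd (upd w i z.1) k z.2 j)) => j.
apply: (@measurable_upd _ R (fun j x => upd w i x j)) => l.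
by rewrite /upd; case: eqP => _; [exact: measurable_id|exact: measurable_cst].
Qed.

Lemma env_measurable_int (g : env -> \bar R) i :
  env_measurable g -> (forall w, 0 <= g w) ->
  env_measurable (fun w => \int[N]_x g (upd w i x)).
Proof.
move=> mg g0 d T phi mphi.
pose G (z : T * R) := g (upd (fun k => phi k z.1) i z.2).
have mG : measurable_fun setT G by apply: mg => j; exact: measurable_upd.
exact: (@measurable_fun_fubini_tonelli_F _ _ _ _ R N G mG (fun=> g0 _)).
Qed.

(** For a duplicate-free [s], this is the conditional expectation of [g] given the coordinates
    outside [s], which keep their values in the environment. *)
Definition Egauss (s : seq nat) (g : env -> \bar R) : env -> \bar R :=
  foldr (fun i h w => \int[N]_x h (upd w i x)) g s.

Lemma Egauss_cons i s g w : Egauss (i :: s) g w = \int[N]_x Egauss s g (upd w i x).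
Proof. by []. Qed.

Lemma Egauss_cat s1 s2 g : Egauss (s1 ++ s2) g = Egauss s1 (Egauss s2 g).
Proof. exact: foldr_cat. Qed.

Lemma Egauss_ge0 s g w : (forall w, 0 <= g w) -> 0 <= Egauss s g w.
Proof.
by move=> g0; elim: s w => //= i s IH w; apply: integral_ge0 => x _; exact: IH.
Qed.

Lemma env_measurable_Egauss s g : env_measurable g -> (forall w, 0 <= g w) ->
  env_measurable (Egauss s g).
Proof.
move=> mg g0; elim: s => //= i s IH.
by apply: env_measurable_int => // w; exact: Egauss_ge0.
Qed.

Lemma measurable_section_Egauss s g w i : env_measurable g -> (forall w, 0 <= g w) ->
  measurable_fun setT (fun x : R => Egauss s g (upd w i x)).
Proof. by move=> mg g0; apply: measurable_section; exact: env_measurable_Egauss. Qed.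

Lemma eq_Egauss s g g' w :
  (forall w', (forall j, j \notin s -> w' j = w j) -> g w' = g' w') ->
  Egauss s g w = Egauss s g' w.
Proof.
elim: s w => [|i s IH] w e; first exact: e.
rewrite !Egauss_cons; apply: eq_integral => x _; apply: IH => w' e'; apply: e => j.
by rewrite inE negb_or => /andP[ji js]; rewrite e'// /upd (negbTE ji).
Qed.

Lemma le_Egauss s g g' w : env_measurable g -> env_measurable g' ->
  (forall w, 0 <= g w) -> (forall w, 0 <= g' w) ->
  (forall w', (forall j, j \notin s -> w' j = w j) -> g w' <= g' w') ->
  Egauss s g w <= Egauss s g' w.
Proof.
move=> mg mg' g0 g'0; elim: s w => [|i s IH] w e; first exact: e.
rewrite !Egauss_cons; apply: (@ge0_le_integral _ _ _ N _ measurableT).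
- by move=> x _; exact: Egauss_ge0.
- exact: measurable_section_Egauss.
- exact: measurable_section_Egauss.
move=> x _; apply: IH => w' e'; apply: e => j.
by rewrite inE negb_or => /andP[ji js]; rewrite e'// /upd (negbTE ji).
Qed.

Lemma Egauss_cst s r w : 0 <= r -> Egauss s (fun=> r) w = r.
Proof.
move=> r0; elim: s w => // i s IH w; rewrite Egauss_cons.
under eq_integral do rewrite IH.
by rewrite integral_cst// -[X in (_ * X)%E]/(N setT) probability_setT mule1.
Qed.

Lemma EgaussD s g g' w : env_measurable g -> env_measurable g' ->
  (forall w, 0 <= g w) -> (forall w, 0 <= g' w) ->
  Egauss s (fun w => g w + g' w) w = Egauss s g w + Egauss s g' w.
Proof.
move=> mg mg' g0 g'0; elim: s w => // i s IH w; rewrite !Egauss_cons.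
under eq_integral do rewrite IH.
rewrite (@ge0_integralD _ _ _ N _ measurableT)//.
- by move=> x _; exact: Egauss_ge0.
- exact: measurable_section_Egauss.
- by move=> x _; exact: Egauss_ge0.
- exact: measurable_section_Egauss.
Qed.

Lemma EgaussZl s g w (r : R) : env_measurable g -> (forall w, 0 <= g w) ->
  (0 <= r)%R -> Egauss s (fun w => r%:E * g w) w = r%:E * Egauss s g w.
Proof.
move=> mg g0 r0; elim: s w => // i s IH w; rewrite !Egauss_cons.
under eq_integral do rewrite IH.
rewrite ge0_integralZl//.
- exact: measurable_section_Egauss.
- by move=> x _; exact: Egauss_ge0.
Qed.

Lemma Egauss_sum (I : Type) (r : seq I) s (g : I -> env -> \bar R) w :
  (forall i, env_measurable (g i)) -> (forall i w, 0 <= g i w) ->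
  Egauss s (fun w => \sum_(i <- r) g i w) w = \sum_(i <- r) Egauss s (g i) w.
Proof.
move=> mg g0; elim: r => [|i r IH].
  by under eq_fun do rewrite big_nil; rewrite big_nil Egauss_cst.
under eq_fun do rewrite big_cons.
rewrite big_cons EgaussD ?IH//.
- move=> d T phi mphi; apply: emeasurable_sum => k; exact: mg.
- by move=> w'; exact: sume_ge0.
Qed.

Lemma Egauss_indep s (S : pred nat) g w w' : (forall j, S j -> w j = w' j) ->
  (forall v v', (forall j, (j \in s) || S j -> v j = v' j) -> g v = g v') ->
  Egauss s g w = Egauss s g w'.
Proof.
elim: s S w w' => [|i s IH] S w w' e gE; first by apply: gE => j; exact: e.
rewrite !Egauss_cons; apply: eq_integral => x _.
apply: (IH (fun j => (j == i) || S j)) => [j|v v' vv'].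
  by rewrite /upd; case: eqP => //= _; exact: e.
by apply: gE => j; rewrite inE -orbA orbCA; exact: vv'.
Qed.

Lemma updC w i k x y : i != k -> upd (upd w i x) k y = upd (upd w k y) i x.
Proof.
move=> ik; apply/funext => j; rewrite /upd.
by have [->|//] := eqVneq j k; rewrite eq_sym (negbTE ik).
Qed.

Lemma Egauss_swap i k s g w : env_measurable g -> (forall w, 0 <= g w) ->
  Egauss (i :: k :: s) g w = Egauss (k :: i :: s) g w.
Proof.
move=> mg g0; have [->//|ik] := eqVneq i k.
have m := measurable_section2 w i k (env_measurable_Egauss s mg g0).
have m0 (z : R * R) : 0 <= Egauss s g (upd (upd w i z.1) k z.2) by exact: Egauss_ge0.
have := @fubini_tonelli _ _ _ _ R N N _ m m0.
rewrite /= => ->.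
by apply: eq_integral => y _; apply: eq_integral => x _; rewrite updC.
Qed.

Lemma Egauss_rem i s g w : env_measurable g -> (forall w, 0 <= g w) ->
  i \in s -> Egauss s g w = Egauss (i :: rem i s) g w.
Proof.
move=> mg g0; elim: s w => // k s IH w; rewrite inE [rem _ _]/=.
have [->//|ik is_] := eqVneq k i.
by rewrite Egauss_swap// !(Egauss_cons k); apply: eq_integral => x _; exact: IH.
Qed.

Lemma Egauss_perm s1 s2 g w : env_measurable g -> (forall w, 0 <= g w) ->
  perm_eq s1 s2 -> Egauss s1 g w = Egauss s2 g w.
Proof.
move=> mg g0; elim: s1 s2 w => [|i s1 IH] s2 w p.
  by move: p; rewrite perm_sym => /perm_nilP ->.
have is2 : i \in s2 by rewrite -(perm_mem p) mem_head.
rewrite (Egauss_rem w mg g0 is2) !Egauss_cons; apply: eq_integral => x _; apply: IH.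
by rewrite -(perm_cons i) (perm_trans p)// perm_to_rem.
Qed.

Lemma Egauss_relabel (rho : nat -> nat) s g w : injective rho ->
  Egauss (map rho s) (fun w => g (w \o rho)) w = Egauss s g (w \o rho).
Proof.
move=> rhoI; elim: s w => // i s IH w; rewrite map_cons !Egauss_cons.
apply: eq_integral => x _; rewrite IH.
by congr (Egauss s g _); apply/funext => j; rewrite /upd /= (inj_eq rhoI).
Qed.

Lemma Egauss_rot i k s g w (c t : R) : env_measurable g -> (forall w, 0 <= g w) ->
  uniq s -> i \in s -> k \in s -> i != k -> (c ^+ 2 + t ^+ 2 = 1)%R ->
  Egauss s (fun w => g (upd (upd w i (c * w i + t * w k)%R) k (- t * w i + c * w k)%R)) w
  = Egauss s g w.
Proof.
move=> mg g0 us is_ ks ik ct.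
pose G w' := g (upd (upd w' i (c * w' i + t * w' k)%R) k (- t * w' i + c * w' k)%R).
have lin (a b : R) : env_measurable (fun w : env => a * w i + b * w k)%R.
  by move=> d T phi mphi; apply: measurable_funD; apply: measurable_funM.
have mG : env_measurable G.
  apply: (env_measurable_comp 
    (h := fun w' => upd (upd w' i (c * w' i + t * w' k)%R) k (- t * w' i + c * w' k)%R)) => // j.
  rewrite /upd; case: eqP => _; first exact: lin.
  by case: eqP => _; [exact: lin|exact: env_measurable_coord].
(* The two rotated coordinates become the innermost integrals, where the planar rotation applies
   with all the others frozen. *)
have p : perm_eq s (rem k (rem i s) ++ [:: i; k]).
  have ki : k \in rem i s by rewrite mem_rem_uniq// inE eq_sym ik.
  rewrite (perm_trans (perm_to_rem is_))//.
  rewrite perm_sym perm_catC /= perm_cons.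
  by rewrite perm_sym perm_to_rem.
rewrite -/G (Egauss_perm w mG (fun=> g0 _) p) (Egauss_perm w mg g0 p) !Egauss_cat.
congr (Egauss _ _ w); apply/funext => w'; rewrite !Egauss_cons.
rewrite -[RHS](@std_normal_rot R _ c t ct (measurable_section2 w' i k mg) (fun=> g0 _)).
apply: eq_integral => x _; apply: eq_integral => y _; congr g; apply/funext => j.
rewrite /= /upd !eqxx (negbTE ik); case: (eqVneq j k) => // jk.
by case: (eqVneq j i).
Qed.

Lemma Egauss_refl i s g w : env_measurable g -> (forall w, 0 <= g w) -> i \in s ->
  Egauss s (fun w => g (upd w i (- w i)%R)) w = Egauss s g w.
Proof.
move=> mg g0 is_.
pose G w' := g (upd w' i (- w' i)%R).
have mG : env_measurable G.
  apply: env_measurable_updl mg => d T phi mphi.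
  exact: measurableT_comp (@oppr_measurable _ _) (mphi i).
have p : perm_eq s (rem i s ++ [:: i]).
  by rewrite (perm_trans (perm_to_rem is_))// perm_sym perm_catC.
rewrite -/G (Egauss_perm w mG (fun=> g0 _) p) (Egauss_perm w mg g0 p) !Egauss_cat.
congr (Egauss _ _ w); apply/funext => w'; rewrite !Egauss_cons.
rewrite -[RHS](ge0_integral_std_normalN (measurable_section w' i mg) (fun=> g0 _)).
apply: eq_integral => x _; congr g; apply/funext => j.
by rewrite /upd eqxx; case: (eqVneq j i).
Qed.

Lemma gauss_expectE n (g : env -> \bar R) :
  gauss_expect n (fun w => g (nth 0%R w)) = Egauss (iota 0 n) g (fun=> 0%R).
Proof.
(* Generalised to a seed whose prefix [pre] is already fixed. Past its end [nth] returns 0, hence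
   the zero environment. *)
have H : forall pre, gauss_expect n (fun w => g (nth 0%R (pre ++ w))) =
    Egauss (iota (size pre) n) g (nth 0%R pre).
  elim: n => [|n IH] pre; first by rewrite /= cats0.
  rewrite [iota _ _]/= Egauss_cons /=; apply: eq_integral => x _.
  have -> : upd (nth 0%R pre) (size pre) x = nth 0%R (rcons pre x).
    apply/funext => j; rewrite /upd nth_rcons.
    have [->|js] := eqVneq j (size pre); first by rewrite ltnn.
    by case: ltnP => // ?; rewrite nth_default.
  by rewrite -(size_rcons pre x) -IH; under eq_fun do rewrite -cat_rcons.
have -> : (fun=> 0%R) = nth 0%R [::] :> env by apply/funext => j; rewrite nth_nil.
exact: (H [::]).
Qed.

End environments.

(** * Centred Gaussian vectors and their Gram matrices *)

Section gaussian_law.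
Context {R : realType}.
Local Notation env := (nat -> R).
Implicit Types (A B : nat -> nat -> R) (s : seq nat) (w : env).

(** Row [a] of [A] holds the coefficients of one component of a Gaussian vector in the independent
    coordinates [s]; [gram] is the covariance of that vector. *)
Definition lin s A w : env := fun a => \sum_(i <- s) A a i * w i.
Definition gram s A a b : R := \sum_(i <- s) A a i * A b i.

Lemma env_measurable_lin s A a : env_measurable (fun w => lin s A w a).
Proof.
move=> d T phi mphi; apply: measurable_sum => i.
by apply: measurable_funM => //.
Qed.

Lemma env_measurable_lin_comp (g : env -> \bar R) s A :
  env_measurable g -> env_measurable (fun w => g (lin s A w)).
Proof. by apply: env_measurable_comp => a; exact: env_measurable_lin. Qed.

(** The Gram matrix is carried along because two vectors are still to be compared through it after
    each has been rotated separately. *)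
Definition same_law s A A' := [/\ forall a b, gram s A a b = gram s A' a b &
  forall (g : env -> \bar R) w, env_measurable g -> (forall v, 0 <= g v)%E ->
    Egauss s (fun w => g (lin s A w)) w = Egauss s (fun w => g (lin s A' w)) w].

Lemma same_law_trans s A B C : same_law s A B -> same_law s B C -> same_law s A C.
Proof.
move=> [gAB lAB] [gBC lBC]; split=> [a b|g w mg g0]; first by rewrite gAB.
by rewrite lAB// lBC.
Qed.

Lemma perm_to_rem2 s (i k : nat) : uniq s -> i \in s -> k \in s -> i != k ->
  exists2 r, perm_eq s (i :: k :: r) & (i \notin r) && (k \notin r).
Proof.
move=> us is_ ks ik.
have ki : k \in rem i s by rewrite mem_rem_uniq// inE eq_sym ik.
have p : perm_eq s (i :: k :: rem k (rem i s)).
  by rewrite (perm_trans (perm_to_rem is_))// perm_cons perm_to_rem.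
exists (rem k (rem i s)) => //.
by move: us; rewrite (perm_uniq p)/= inE negb_or => /and3P[/andP[_ ->] ->].
Qed.

Lemma same_law_rot s A i k (c t : R) : uniq s -> i \in s -> k \in s -> i != k ->
  c ^+ 2 + t ^+ 2 = 1 ->
  same_law s A (fun a j => if j == i then c * A a i + t * A a k
    else if j == k then - t * A a i + c * A a k else A a j).
Proof.
move=> us is_ ks ik ct; have ki : (k == i) = false by rewrite eq_sym (negbTE ik).
have [r p /andP[ir kr]] := perm_to_rem2 us is_ ks ik.
have ne j : j \in r -> (j == i = false) * (j == k = false).
  by move=> jr; split; apply/negP => /eqP e; move: ir kr; rewrite -?e jr.
split=> [a b|g w mg g0].
  rewrite /gram !(perm_big _ p)/= !big_cons !eqxx ki.
  rewrite [in RHS](eq_big_seq (fun j => A a j * A b j)); last first.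
    by move=> j jr; rewrite !ne.
  rewrite !addrA; congr (_ + _).
  transitivity ((c ^+ 2 + t ^+ 2) * (A a i * A b i + A a k * A b k)); last by ring.
  by rewrite ct mul1r.
(* Rotating the columns of [A] amounts to rotating the coordinates by the opposite angle. *)
have ct' : c ^+ 2 + (- t) ^+ 2 = 1 by rewrite sqrrN.
rewrite -(Egauss_rot w (env_measurable_lin_comp s A mg) (fun=> g0 _) us is_ ks ik ct').
apply: eq_Egauss => w' _; congr g; apply/funext => a.
rewrite /lin !(perm_big _ p)/= !big_cons /upd !eqxx (negbTE ik) ki.
rewrite !addrA; congr (_ + _); first by ring.
by apply: eq_big_seq => j jr; rewrite !ne.
Qed.

Lemma same_law_refl s A i : uniq s -> i \in s ->
  same_law s A (fun a j => if j == i then - A a i else A a j).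
Proof.
move=> us is_; split=> [a b|g w mg g0].
  by apply: eq_bigr => j _; case: eqP => [->|//]; rewrite mulrNN.
rewrite -(Egauss_refl w (env_measurable_lin_comp s A mg) (fun=> g0 _) is_).
apply: eq_Egauss => w' _; congr g; apply/funext => a; apply: eq_bigr => j _.
by rewrite /upd; case: eqP => [->|//]; rewrite mulrN mulNr.
Qed.

(** The sign of the pivot makes it recoverable from the Gram matrix: it is the nonnegative square
    root of the entry at [0, 0]. *)
Lemma same_law_row0 s A i : uniq (i :: s) ->
  exists A', [/\ same_law (i :: s) A A', forall k, k \in s -> A' 0%N k = 0 &
    0 <= A' 0%N i].
Proof.
move=> us; have iis : i \in i :: s by rewrite mem_head.
have [A' [sA A'0]] : exists A', same_law (i :: s) A A' /\
    forall k, k \in s -> A' 0%N k = 0.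
  (* [l] lists the entries of row 0 already cleared. A rotation in the plane of [i] and [k] clears
     entry [k] without touching the other columns, so the zeros obtained before survive. *)
  suff H (l : seq nat) : {subset l <= s} -> exists A', same_law (i :: s) A A' /\
    forall k, k \in l -> A' 0%N k = 0 by exact: H.
  elim: l => [|k l IH] sub; first by exists A.
  have [B [sB B0]] := IH (fun j jl => sub j (mem_behead (s := k :: l) jl)).
  have ks : k \in s by apply: sub; rewrite mem_head.
  have ik : i != k.
    by apply/eqP => e; move: us; rewrite /= e ks.
  have kis : k \in i :: s by rewrite inE ks orbT.
  set x := B 0%N i; set y := B 0%N k; set n := Num.sqrt (x ^+ 2 + y ^+ 2).
  have [n0|n0] := eqVneq n 0.
    exists B; split=> // j; rewrite inE => /orP[/eqP ->|/B0//].
    have /eqP := n0; rewrite sqrtr_eq0 => xy.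
    by apply/eqP; rewrite -sqrf_eq0 eq_le sqr_ge0 andbT; have := sqr_ge0 x;
      rewrite -/y; lra.
  have nn : n ^+ 2 = x ^+ 2 + y ^+ 2 by rewrite sqr_sqrtr// addr_ge0 ?sqr_ge0.
  have cs : (x / n) ^+ 2 + (y / n) ^+ 2 = 1.
    by rewrite !expr_div_n -mulrDl -nn divff// expf_neq0.
  have sC := same_law_rot B us iis kis ik cs.
  eexists; split; first exact: same_law_trans sB sC.
  move=> j jl /=; have js : j \in s by exact: sub.
  have -> : (j == i) = false.
    by apply/negP => /eqP e; move: us; rewrite /= -e js.
  have [jk|jk] := eqVneq j k; last by apply: B0; move: jl; rewrite inE (negbTE jk).
  by rewrite -/x -/y; ring.
have [i0|i0] := leP 0 (A' 0%N i); first by exists A'.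
exists (fun a j => if j == i then - A' a i else A' a j); split.
- exact: same_law_trans sA (same_law_refl A' us iis).
- move=> k ks; have -> : (k == i) = false; last exact: A'0.
  by apply/negP => /eqP e; move: us; rewrite /= -e ks.
- by rewrite eqxx oppr_ge0 ltW.
Qed.

(* A centred Gaussian vector is determined in law by its Gram matrix: Givens
   rotations turn the first row into [alpha, 0, ..., 0], which pins down the first
   column, and the remaining block is handled by induction on the number of rows. *)
Lemma eq_gram_Egauss m s A B (g : env -> \bar R) w : uniq s ->
  (forall a b, (a < m)%N -> (b < m)%N -> gram s A a b = gram s B a b) ->
  env_measurable g -> (forall v, 0 <= g v)%E ->
  (forall v v', (forall a, (a < m)%N -> v a = v' a) -> g v = g v') ->
  Egauss s (fun w => g (lin s A w)) w = Egauss s (fun w => g (lin s B w)) w.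
Proof.
elim: m s A B g w => [|m IH] s A B g w us gAB mg g0 gm.
  by apply: eq_Egauss => w' _; exact: gm.
case: s us gAB => [|i s] us gAB.
  by congr g; apply/funext => a; rewrite /lin !big_nil.
have [A' [[gA ->//] A'0 A'i]] := same_law_row0 A us.
have [B' [[gB ->//] B'0 B'i]] := same_law_row0 B us.
have {gAB}gAB a b : (a < m.+1)%N -> (b < m.+1)%N ->
  gram (i :: s) A' a b = gram (i :: s) B' a b by move=> am bm; rewrite -gA -gB gAB.
have gram0 C a : (forall k, k \in s -> C 0%N k = 0) ->
    gram (i :: s) C 0%N a = C 0%N i * C a i.
  move=> C0; rewrite /gram big_cons big_seq big1 ?addr0// => k ks.
  by rewrite C0// mul0r.
have AB : A' 0%N i = B' 0%N i.
  by apply/eqP; rewrite -(@eqrXn2 _ 2)// !expr2 -!gram0// gAB.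
pose sh (C : nat -> nat -> R) a := C a.+1.
pose ext (u : env) x (v : env) : env := fun a => if a is a'.+1 then u a' * x + v a' else u 0 * x.
(* A zero pivot means that component 0 vanishes identically on both sides: it is dropped, and all
   coordinates remain available to the other rows. *)
have [a0|a0] := eqVneq (A' 0%N i) 0.
  pose h (v : env) := g (fun a => if a is a'.+1 then v a' else 0).
  have hE C w' : (forall k, k \in s -> C 0%N k = 0) -> C 0%N i = 0 ->
      g (lin (i :: s) C w') = h (lin (i :: s) (sh C) w').
    move=> C0 Ci; congr g; apply/funext => -[|a] //.
    rewrite /lin big_cons Ci mul0r add0r big_seq big1// => k ks.
    by rewrite C0// mul0r.
  rewrite (eq_Egauss (g' := fun w => h (lin (i :: s) (sh A') w))); last first.
    by move=> w' _; exact: hE.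
  rewrite [RHS](eq_Egauss (g' := fun w => h (lin (i :: s) (sh B') w))); last first.
    by move=> w' _; apply: hE => //; rewrite -AB.
  apply: IH => //.
  - by move=> a b am bm; exact: gAB.
  - apply: (env_measurable_comp (h := fun v a => if a is a'.+1 then v a' else 0)) => //.
    by case=> [|a]; [exact: env_measurable_cst|exact: env_measurable_coord].
  - by move=> v; exact: g0.
  - by move=> v v' e; apply: gm => -[|a] //; exact: e.
(* The Gram entry at [0, a] is the pivot times the entry of row [a] in column [i]. *)
have colE a : (a < m.+1)%N -> A' a i = B' a i.
  move=> am; apply: (mulfI a0); rewrite -gram0//.
  by rewrite gAB// gram0// AB.
rewrite !Egauss_cons; apply: eq_integral => x _.
(* With coordinate [i] frozen at [x], the common column [i] is a deterministic shift, absorbed into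
   the test function. *)
pose h (v : env) := g (fun a => A' a i * x + (if a is a'.+1 then v a' else 0)).
have hE C w' : (forall k, k \in s -> C 0%N k = 0) ->
    (forall a, (a < m.+1)%N -> C a i = A' a i) ->
    (forall j, j \notin s -> w' j = upd w i x j) ->
    g (lin (i :: s) C w') = h (lin s (sh C) w').
  move=> C0 Ci e; apply: gm => a am; rewrite /lin big_cons Ci//.
  rewrite e ?(andP us).1// /upd eqxx; congr (_ + _); case: a am => // _.
  by rewrite big_seq big1// => k ks; rewrite C0// mul0r.
rewrite (eq_Egauss (g' := fun w => h (lin s (sh A') w))); last first.
  by move=> w' e; exact: hE.
rewrite [RHS](eq_Egauss (g' := fun w => h (lin s (sh B') w))); last first.
  by move=> w' e; apply: hE => // a am; rewrite colE.
have us' : uniq s by case/andP: us.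
apply: IH => //.
- move=> a b am bm; have := gAB a.+1 b.+1 am bm.
  by rewrite /gram !big_cons !colE// => /addrI.
- apply: (env_measurable_comp (h := fun v a => A' a i * x + (if a is a'.+1 then v a' else 0))) => // a.
  move=> d T phi mphi; apply: measurable_funD => //.
  by case: a.
- by move=> v; exact: g0.
- by move=> v v' e; apply: gm => -[|a] //= am; rewrite e.
Qed.

Lemma env_measurable_expsq (g : env -> R) :
  env_measurable g -> env_measurable (fun v => (expR (g v ^+ 2 / 4))%:E).
Proof.
move=> mg d' U phi mphi; apply/measurable_EFinP; apply: measurableT_comp => //.
by apply: measurable_funM => //; apply: measurable_funX; exact: mg.
Qed.

(** The standard density times [expR (x ^+ 2 / 4)] is [sqrt 2] times the density of variance 2. The
    exponent has to stay below [x ^+ 2 / 2] for the integral to be finite. *)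
Lemma integral_std_normal_expsq :
  (\int[normal_prob (0:R) 1]_x (expR (x ^+ 2 / 4))%:E = (Num.sqrt 2)%:E)%E.
Proof.
have s2 : 0 < Num.sqrt 2 :> R by rewrite sqrtr_gt0.
rewrite ge0_integral_std_normal//; last first.
  by apply: (env_measurable_expsq (env_measurable_coord 0) (phi := fun _ x => x)).
transitivity (\int[@lebesgue_measure R]_x ((Num.sqrt 2)%:E * (normal_pdf 0 (Num.sqrt 2) x)%:E))%E.
  apply: eq_integral => x _; rewrite -!EFinM std_normal_pdfE normal_pdfE ?gt_eqF//.
  congr EFin; rewrite /normal_fun subr0 sqr_sqrtr// -mulrA -expRD mulrA.
  congr (_ * expR _); last by field.
  rewrite /normal_peak sqr_sqrtr// expr1n mul1r -[2 * pi *+ 2]mulrnAr sqrtrM// invfM mulrA.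
  by rewrite divff ?mul1r// gt_eqF.
rewrite ge0_integralZl//.
- by rewrite integral_normal_pdf mule1.
- by apply/measurable_EFinP; exact: measurable_normal_pdf.
- by move=> x _; rewrite lee_fin normal_pdf_ge0.
Qed.

(** A component of variance 1 has the law of the single coordinate [i], by comparison of Gram
    matrices with one row. *)
Lemma Egauss_lin_expsq s A i w : uniq s -> i \in s -> gram s A 0%N 0%N = 1 ->
  Egauss s (fun w => (expR (lin s A w 0%N ^+ 2 / 4))%:E) w = (Num.sqrt 2)%:E.
Proof.
move=> us is_ g1.
have linE (u : env) : lin s (fun _ j => (j == i)%:R) u 0%N = u i.
  rewrite /lin (bigD1_seq i)//= eqxx mul1r big1 ?addr0// => j /negbTE ->.
  by rewrite mul0r.
pose g (v : env) : \bar R := (expR (v 0%N ^+ 2 / 4))%:E.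
have g0 v : (0 <= g v)%E by rewrite lee_fin expR_ge0.
have mg i' : env_measurable (fun v : env => (expR (v i' ^+ 2 / 4))%:E).
  exact: (env_measurable_expsq (env_measurable_coord i')).
rewrite (@eq_gram_Egauss 1 s A (fun _ j => (j == i)%:R) g w us)//; first last.
- by move=> v v' e; rewrite /g e.
- exact: mg.
- move=> [|//] [|//] _ _; rewrite g1 /gram (bigD1_seq i)//= eqxx mul1r big1 ?addr0//.
  by move=> j /negbTE ->; rewrite mul0r.
rewrite (eq_Egauss (g' := fun v : env => (expR (v i ^+ 2 / 4))%:E)); last first.
  by move=> w' _; rewrite /g linE.
have p : perm_eq s (rem i s ++ [:: i]).
  by rewrite (perm_trans (perm_to_rem is_))// perm_sym perm_catC.
rewrite (Egauss_perm w (mg i) _ p); last by move=> v; rewrite lee_fin expR_ge0.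
rewrite Egauss_cat (eq_Egauss (g' := fun=> (Num.sqrt 2)%:E)).
  by rewrite Egauss_cst// lee_fin sqrtr_ge0.
move=> w' _; rewrite Egauss_cons -integral_std_normal_expsq; apply: eq_integral => x _.
by rewrite /= /upd eqxx.
Qed.

End gaussian_law.

(** * Gaussian process posteriors and information gain *)

Section bordered.
Context {F : fieldType} (m : nat) (G : 'M[F]_m) (b : 'cV[F]_m) (d : 'rV[F]_m) (c : F).

(** The Schur complement of [G]. For observations of a Gaussian process it is the posterior variance
    at the new point plus the noise variance. *)
Let s := c - (d *m invmx G *m b) 0 0.

Lemma det_bordered : G \in unitmx -> \det (block_mx G b d c%:M) = s * \det G.
Proof.
move=> uG; have -> : block_mx G b d c%:M =
    block_mx 1%:M 0 (d *m invmx G) 1%:M *m block_mx G b 0 s%:M.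
  rewrite mulmx_block !mul1mx !mul0mx !addr0 mulmxKV//.
  congr (block_mx _ _ _ _).
  by apply/matrixP => i j; rewrite !mxE !ord1 /s mulr1n addrC [(d *m _ *m b) 0 0]mxE subrK.
by rewrite det_mulmx det_lblock det_ublock !det1 !mul1r det_scalar expr1 mulrC.
Qed.

(** Posterior mean and covariance involve the inverse only between two factors; in this form one
    rank-one correction updates both. *)
Lemma invmx_bordered n l (P : 'M[F]_(n, m)) (q : 'cV[F]_n) (Q : 'M[F]_(m, l)) (r : 'rV[F]_l) :
  G \in unitmx -> s != 0 ->
  row_mx P q *m invmx (block_mx G b d c%:M) *m col_mx Q r =
  P *m invmx G *m Q +
    s^-1 *: ((q - P *m invmx G *m b) *m (r - d *m invmx G *m Q)).
Proof.
move=> uG s0.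
have uB : block_mx G b d c%:M \in unitmx.
  by rewrite unitmxE det_bordered// unitrM unitfE s0 -unitmxE.
(* The last component of the solution of the bordered system with right-hand side [col_mx Q r],
   found by block elimination. *)
pose x := s^-1 *: (r - d *m invmx G *m Q).
have -> : col_mx Q r = block_mx G b d c%:M *m col_mx (invmx G *m Q - invmx G *m b *m x) x.
  rewrite mul_block_col !mulmxBr !mulmxA mulmxV// !mul1mx subrK; congr (col_mx _ _).
  have -> : d *m invmx G *m b = (c - s)%:M.
    by rewrite [LHS]mx11_scalar /s; congr (_%:M); ring.
  rewrite !mul_scalar_mx -addrA -scaleNr -scalerDl.
  have -> : - (c - s) + c = s by ring.
  by rewrite /x scalerA divff// scale1r addrC subrK.
rewrite -mulmxA mulKmx// mul_row_col mulmxBr !mulmxA -addrA; congr (_ + _).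
by rewrite scalemxAr -/x mulmxBl addrC.
Qed.

End bordered.

(** * Rank-one posterior updates and the chain rule for information *)

Section posterior.
Context {R : realType} (sigma : R) (zmax : nat).
Variable k : 'I_zmax.+1 -> 'I_zmax.+1 -> R.
Hypotheses (sigma_gt0 : 0 < sigma) (kP : kernel_ok k).
Local Notation Z := 'I_zmax.+1.
Implicit Types (zo : nat -> Z) (yo : nat -> R) (obs : seq (Z * R)).

(** The observed points are a total function of which the first [m] values count, so that a new
    observation changes only [m]. *)
Definition pG m zo : 'M[R]_m := (\matrix_(a, b) k (zo a) (zo b)) + (sigma ^+ 2)%:M.
Definition pX m zo : 'M[R]_(zmax.+1, m) := \matrix_(z, b) k z (zo b).
Definition pcov m zo := Kmat k - pX m zo *m invmx (pG m zo) *m (pX m zo)^T.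
Definition pmean m zo yo := pX m zo *m invmx (pG m zo) *m \col_(b < m) yo b.
Definition infodet m zo : R := \det (1%:M + sigma^-2 *: \matrix_(a < m, b < m) k (zo a) (zo b)).

Lemma kernel_sym z z' : k z z' = k z' z.
Proof. by case: kP => -[/matrixP /(_ z' z)]; rewrite !mxE. Qed.

Lemma post_covE obs :
  post_cov sigma k obs = pcov (size obs) (fun i => (nth (ord0, 0) obs i).1).
Proof. by []. Qed.

Lemma post_meanE obs :
  post_mean sigma k obs = pmean (size obs) (fun i => (nth (ord0, 0) obs i).1)
    (fun i => (nth (ord0, 0) obs i).2).
Proof. by []. Qed.

Lemma pG_ext m zo zo' : (forall i, (i < m)%N -> zo i = zo' i) -> pG m zo = pG m zo'.
Proof. by move=> e; apply/matrixP => i j; rewrite !mxE !e. Qed.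

Lemma pX_ext m zo zo' : (forall i, (i < m)%N -> zo i = zo' i) -> pX m zo = pX m zo'.
Proof. by move=> e; apply/matrixP => i j; rewrite !mxE !e. Qed.

Lemma pcov_ext m zo zo' : (forall i, (i < m)%N -> zo i = zo' i) -> pcov m zo = pcov m zo'.
Proof. by move=> e; rewrite /pcov (pX_ext e) (pG_ext e). Qed.

Lemma pmean_ext m zo zo' yo yo' : (forall i, (i < m)%N -> zo i = zo' i) ->
  (forall i, (i < m)%N -> yo i = yo' i) -> pmean m zo yo = pmean m zo' yo'.
Proof.
move=> e f; rewrite /pmean (pX_ext e) (pG_ext e); congr (_ *m _).
by apply/matrixP => i j; rewrite !mxE f.
Qed.

Lemma infodet_ext m zo zo' : (forall i, (i < m)%N -> zo i = zo' i) ->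
  infodet m zo = infodet m zo'.
Proof.
by move=> e; rewrite /infodet; congr (\det (_ + _ *: _));
  apply/matrixP => i j; rewrite !mxE !e.
Qed.

Section step.
Variables (m : nat) (zo : nat -> Z) (yo : nat -> R).
Let b : 'cV[R]_m := \col_a k (zo a) (zo m).
Let q : 'cV[R]_zmax.+1 := \col_z k z (zo m).

(** The size [m + 1], rather than [m.+1], is the type of a block matrix. *)
Let pG_step : pG (m + 1) zo = block_mx (pG m zo) b b^T (k (zo m) (zo m) + sigma ^+ 2)%:M.
Proof.
apply/matrixP => i j.
case: (split_ordP i) => i' ->; case: (split_ordP j) => j' ->;
  rewrite ?block_mxEul ?block_mxEur ?block_mxEdl ?block_mxEdr !mxE /=
    ?eq_shift ?ord1 ?addn0 ?mulr0n ?addr0 ?mulr1n//.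
exact: kernel_sym.
Qed.

Let pX_step : pX (m + 1) zo = row_mx (pX m zo) q.
Proof.
apply/matrixP => i j.
by case: (split_ordP j) => j' ->; rewrite ?row_mxEl ?row_mxEr !mxE /= ?ord1 ?addn0.
Qed.

Let bE : b = col (zo m) (pX m zo)^T.
Proof. by apply/matrixP => i j; rewrite !mxE kernel_sym. Qed.

Let pcovE u v : pcov m zo u v = k u v - (pX m zo *m invmx (pG m zo) *m (pX m zo)^T) u v.
Proof. by rewrite /pcov mxE [Kmat _ _ _]mxE [X in _ + X]mxE. Qed.

Let pcovE1 u v : pcov (m + 1) zo u v =
  k u v - (pX (m + 1) zo *m invmx (pG (m + 1) zo) *m (pX (m + 1) zo)^T) u v.
Proof. by rewrite /pcov mxE [Kmat _ _ _]mxE [X in _ + X]mxE. Qed.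

Let mxcolE n p (A : 'M[R]_(n, m)) (B : 'M[R]_(m, p)) j :
  A *m col j B = col j (A *m B).
Proof. by rewrite !colE mulmxA. Qed.

Let schurE : k (zo m) (zo m) + sigma ^+ 2 - (b^T *m invmx (pG m zo) *m b) 0 0 =
  pcov m zo (zo m) (zo m) + sigma ^+ 2.
Proof.
rewrite pcovE bE tr_col trmxK mxcolE [in LHS]mxE -mulmxA -row_mul mxE mulmxA; ring.
Qed.

Hypothesis uG : pG m zo \in unitmx.
Hypothesis s_gt0 : 0 < pcov m zo (zo m) (zo m) + sigma ^+ 2.

Lemma det_pG_step :
  \det (pG (m + 1) zo) = (pcov m zo (zo m) (zo m) + sigma ^+ 2) * \det (pG m zo).
Proof. by rewrite pG_step det_bordered// schurE. Qed.

Lemma pcov_step u v : pcov (m + 1) zo u v = pcov m zo u v -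
  (pcov m zo (zo m) (zo m) + sigma ^+ 2)^-1 * (pcov m zo u (zo m) * pcov m zo (zo m) v).
Proof.
rewrite pcovE1 pG_step pX_step tr_row_mx invmx_bordered//; last first.
  by rewrite schurE gt_eqF.
rewrite schurE [X in _ - X]mxE opprD addrA -pcovE; congr (_ - _); rewrite [in LHS]mxE; congr (_ * _).
rewrite [LHS]mxE big_ord1; congr (_ * _).
  by rewrite pcovE bE mxcolE !mxE.
rewrite pcovE bE tr_col trmxK -mulmxA -row_mul mulmxA !mxE; congr (_ - _).
exact: kernel_sym.
Qed.

Lemma pmean_step u : pmean (m + 1) zo yo u 0 = pmean m zo yo u 0 +
  (pcov m zo (zo m) (zo m) + sigma ^+ 2)^-1 *
    (pcov m zo u (zo m) * (yo m - pmean m zo yo (zo m) 0)).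
Proof.
have -> : pmean (m + 1) zo yo = pX (m + 1) zo *m invmx (pG (m + 1) zo) *m
    col_mx (\col_(b < m) yo b) (yo m)%:M.
  congr (_ *m _); apply/matrixP => i j.
  by case: (split_ordP i) => i' ->; rewrite ?col_mxEu ?col_mxEd !mxE /= ?ord1 ?addn0 ?mulr1n.
rewrite pG_step pX_step invmx_bordered//; last by rewrite schurE gt_eqF.
rewrite schurE [in LHS]mxE; congr (_ + _); rewrite [in LHS]mxE; congr (_ * _).
rewrite [LHS]mxE big_ord1; congr (_ * _).
  by rewrite pcovE bE mxcolE !mxE.
by rewrite bE tr_col trmxK -mulmxA -row_mul mulmxA !mxE mulr1n.
Qed.

End step.

Lemma quad_formE n (S : 'M[R]_n) (v : 'rV[R]_n) :
  (v *m S *m v^T) 0 0 = \sum_i \sum_j v 0 i * S i j * v 0 j.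
Proof.
rewrite mxE exchange_big; apply: eq_bigr => j _; rewrite mxE mulr_suml.
by apply: eq_bigr => i _; rewrite mxE.
Qed.

Lemma psd_diag_ge0 n (S : 'M[R]_n) i : psd S -> 0 <= S i i.
Proof.
move=> [_ /(_ (delta_mx 0 i))]; rewrite -rowE mxE (bigD1 i)//= big1 => [|j ji].
  by rewrite !mxE !eqxx mulr1 addr0.
by rewrite !mxE (negbTE ji) andbF mulr0.
Qed.

Lemma psd_downdate n (S : 'M[R]_n) z t : psd S -> 0 < t ->
  psd (\matrix_(u, v) (S u v - (S z z + t)^-1 * (S u z * S z v))).
Proof.
move=> Spsd t0; have Szz := psd_diag_ge0 z Spsd; have [symS posS] := Spsd.
have sS i j : S i j = S j i by move/matrixP: symS => /(_ j i); rewrite mxE.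
split.
  by apply/matrixP => i j; rewrite !mxE (sS j i) (sS j z) (sS z i) [S z j * _]mulrC.
move=> v; rewrite quad_formE.
set a := S z z in Szz *; set p := \sum_i v 0 i * S i z.
have a0 : 0 < a + t by rewrite ltr_wpDl.
have pE : p = \sum_j S z j * v 0 j by apply: eq_bigr => j _; rewrite mulrC sS.
set qv := \sum_i \sum_j v 0 i * S i j * v 0 j.
have -> : \sum_i \sum_j v 0 i *
   (\matrix_(u, v) (S u v - (a + t)^-1 * (S u z * S z v))) i j * v 0 j =
   qv - (a + t)^-1 * (p * p).
  rewrite {2}pE [p * _]mulr_suml mulr_sumr -sumrB; apply: eq_bigr => i _.
  rewrite mulr_sumr mulr_sumr -sumrB; apply: eq_bigr => j _; rewrite !mxE; ring.
(* Cauchy-Schwarz, from positivity at [v - t0 e_z] with [t0 = p / (a + t)] *)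
pose x := (a + t)^-1 * p.
set e : 'rV[R]_n := delta_mx 0 z.
have := posS (v - x *: e).
have -> : ((v - x *: e) *m S *m (v - x *: e)^T) 0 0 = qv - 2 * x * p + x ^+ 2 * a.
  have vv : (v *m S *m v^T) 0 0 = qv by rewrite quad_formE.
  have ev : (e *m S *m v^T) 0 0 = p.
    by rewrite -rowE pE mxE; apply: eq_bigr => j _; rewrite !mxE.
  have ve : (v *m S *m e^T) 0 0 = p by rewrite trmx_delta -colE !mxE.
  have ee : (e *m S *m e^T) 0 0 = a by rewrite trmx_delta -colE -rowE !mxE.
  have -> : (v - x *: e)^T = v^T - x *: e^T by rewrite linearB linearZ.
  rewrite !mulmxBl !mulmxBr -!scalemxAl -!scalemxAr.
  move: vv ev ve ee; set A1 := v *m S *m v^T; set A2 := e *m S *m v^T.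
  set A3 := v *m S *m e^T; set A4 := e *m S *m e^T => vv ev ve ee.
  by clearbody A1 A2 A3 A4; rewrite !mxE vv ev ve ee; ring.
have -> : p = (a + t) * x by rewrite /x mulrA divff ?mul1r// gt_eqF.
have -> : (a + t)^-1 * ((a + t) * x * ((a + t) * x)) = (a + t) * x ^+ 2.
  by field; rewrite gt_eqF.
have := sqr_ge0 x; nra.
Qed.

(** The two claims feed each other: a positive determinant makes [pG] invertible, which validates
    the update of [pcov], and a nonnegative variance makes the next Schur complement, hence the next
    determinant, positive. *)
Lemma pcov_psd_det m zo : psd (pcov m zo) /\ 0 < \det (pG m zo).
Proof.
elim: m => [|m [IHp IHd]].
  split; last by rewrite det_mx00.
  by rewrite /pcov [pX 0 zo]thinmx0 !mul0mx subr0; case: kP.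
have uG : pG m zo \in unitmx by rewrite unitmxE unitfE gt_eqF.
have z0 := psd_diag_ge0 (zo m) IHp.
have s0 : 0 < pcov m zo (zo m) (zo m) + sigma ^+ 2 by rewrite ltr_wpDl// exprn_gt0.
rewrite -(addn1 m) det_pG_step// mulr_gt0//; split=> //.
have -> : pcov (m + 1) zo = \matrix_(u, v) (pcov m zo u v -
    (pcov m zo (zo m) (zo m) + sigma ^+ 2)^-1 * (pcov m zo u (zo m) * pcov m zo (zo m) v)).
  by apply/matrixP => u v; rewrite [RHS]mxE pcov_step.
by apply: psd_downdate => //; rewrite exprn_gt0.
Qed.

Lemma pG_unit m zo : pG m zo \in unitmx.
Proof. by rewrite unitmxE unitfE gt_eqF//; case: (pcov_psd_det m zo). Qed.

Lemma pcov_diag_ge0 m zo z : 0 <= pcov m zo z z.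
Proof. by apply: psd_diag_ge0; case: (pcov_psd_det m zo). Qed.

Lemma pcov_noise_gt0 m zo z : 0 < pcov m zo z z + sigma ^+ 2.
Proof. by rewrite ltr_wpDl ?exprn_gt0// pcov_diag_ge0. Qed.

Lemma pcov_sym m zo u v : pcov m zo u v = pcov m zo v u.
Proof.
by case: (pcov_psd_det m zo) => -[/matrixP /(_ v u)]; rewrite mxE.
Qed.

Lemma pcov_le_prior m zo z : pcov m zo z z <= k z z.
Proof.
elim: m => [|m IH].
  by rewrite /pcov [pX 0 zo]thinmx0 !mul0mx subr0 mxE.
rewrite -(addn1 m) pcov_step ?pG_unit ?pcov_noise_gt0//.
apply: le_trans IH; rewrite gerBl mulr_ge0 ?invr_ge0 ?(ltW (pcov_noise_gt0 _ _ _))//.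
by rewrite (pcov_sym m zo (zo m)) -expr2 sqr_ge0.
Qed.

Lemma infodetE m zo : infodet m zo = sigma^-2 ^+ m * \det (pG m zo).
Proof.
rewrite /infodet -detZ /pG scalerDr scale_scalar_mx addrC; congr (\det (_ + _%:M)).
by rewrite mulVf// expf_neq0// gt_eqF.
Qed.

Lemma infodet_gt0 m zo : 0 < infodet m zo.
Proof.
rewrite infodetE mulr_gt0 ?exprn_gt0 ?invr_gt0//.
by rewrite exprn_gt0.
by case: (pcov_psd_det m zo).
Qed.

(** The mutual information between the function and a noisy observation at [z], given the first [m]
    observations. *)
Definition gain m zo z : R := 2^-1 * ln (1 + sigma^-2 * pcov m zo z z).

Lemma gain_arg_ge1 m zo z : 1 <= 1 + sigma^-2 * pcov m zo z z.
Proof. by rewrite lerDl mulr_ge0 ?pcov_diag_ge0// invr_ge0 exprn_ge0// ltW. Qed.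

Lemma gain_ge0 m zo z : 0 <= gain m zo z.
Proof. by rewrite mulr_ge0// ln_ge0 ?gain_arg_ge1. Qed.

Definition info m zo : R := 2^-1 * ln (infodet m zo).

Lemma info_step m zo : info (m + 1) zo = info m zo + gain m zo (zo m).
Proof.
rewrite /info /gain -mulrDr addrC; congr (_ * _).
rewrite infodetE det_pG_step ?pG_unit ?pcov_noise_gt0//.
rewrite -lnM ?posrE ?infodet_gt0 ?(lt_le_trans ltr01 (gain_arg_ge1 _ _ _))//.
congr ln; rewrite infodetE exprD expr1.
have -> : 1 + sigma^-2 * pcov m zo (zo m) (zo m) =
    sigma^-2 * (pcov m zo (zo m) (zo m) + sigma ^+ 2).
  by field; rewrite gt_eqF.
ring.
Qed.

Lemma info0 zo : info 0 zo = 0.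
Proof. by rewrite /info /infodet det_mx00 ln1 mulr0. Qed.

Lemma info_mono m n zo : (m <= n)%N -> info m zo <= info n zo.
Proof.
move=> /subnKC <-; elim: (n - m)%N => [|j IH]; first by rewrite addn0.
by rewrite addnS -(addn1 (m + j)) info_step (le_trans IH)// lerDl gain_ge0.
Qed.

Lemma info_le_gammaN m N zo : (m <= N)%N -> info m zo <= gammaN sigma k N.
Proof.
move=> mN; apply: le_trans (info_mono zo mN) _; rewrite /gammaN.
apply: le_trans (le_bigmax_cond _ (fun zs : {ffun 'I_N -> Z} =>
  2^-1 * ln (\det (1%:M + sigma^-2 *: \matrix_(a, b) k (zs a) (zs b))))
  (j := [ffun a : 'I_N => zo a]) isT).
rewrite /info /infodet le_eqVlt; apply/orP; left; apply/eqP.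
by congr (_ * ln (\det (_ + _ *: _))); apply/matrixP => i j; rewrite !mxE !ffunE.
Qed.

Lemma gammaN_ge0 N : 0 <= gammaN sigma k N.
Proof. by rewrite -(info0 (fun=> ord0)) info_le_gammaN. Qed.

(** Conditioning does not increase the variance, so an observation gains most when it is the first.
    This lets one observation in excess be charged to [gammaN]. *)
Lemma gain_le_prior m zo z : gain m zo z <= info 1 (fun=> z).
Proof.
rewrite -[1%N]/(0 + 1)%N info_step info0 add0r /gain ler_pM2l ?invr_gt0//.
rewrite ler_ln ?posrE ?(lt_le_trans ltr01 (gain_arg_ge1 _ _ _))//.
rewrite lerD2l ler_pM2l ?invr_gt0 ?exprn_gt0//.
rewrite [leRHS](_ : _ = k z z) ?pcov_le_prior//.
by rewrite /pcov [pX 0 _]thinmx0 !mul0mx subr0 mxE.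
Qed.

(* The last of the [T / d + 1] batches may make one arm be observed [T + 1] times. *)
Lemma info_le_2gammaN m N zo : (0 < N)%N -> (m <= N.+1)%N ->
  info m zo <= 2 * gammaN sigma k N.
Proof.
move=> N0 mN; rewrite mulr_natl mulr2n; apply: le_trans (info_mono zo mN) _.
rewrite -(addn1 N) info_step lerD ?info_le_gammaN//.
by apply: le_trans (gain_le_prior _ _ _) _; exact: info_le_gammaN.
Qed.

(** With [v] the variance and [y = 1 + v / sigma ^+ 2], the bound [ln y >= 1 - 1 / y] gives
    [ln y >= v / (sigma ^+ 2 + v)], and [v <= 1] by the normalisation of the kernel. The factor 2
    undoes the one half in [gain]. *)
Lemma pcov_le_gain m zo z : pcov m zo z z <= 2 * (1 + sigma ^+ 2) * gain m zo z.
Proof.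
set v := pcov m zo z z; have v0 : 0 <= v by exact: pcov_diag_ge0.
have v1 : v <= 1 by case: kP => _ /(_ z); apply: le_trans; exact: pcov_le_prior.
have s2 : 0 < sigma ^+ 2 by rewrite exprn_gt0.
rewrite /gain -/v; set y := (X in ln X); have y1 : 1 <= y by exact: gain_arg_ge1.
have y0 : 0 < y by exact: lt_le_trans ltr01 y1.
have yE : sigma ^+ 2 * y = sigma ^+ 2 + v by rewrite /y; field; rewrite gt_eqF.
have : ln y^-1 <= y^-1 - 1.
  by rewrite -{1}[y^-1](subrK 1) addrC le_ln1Dx// ltrBrDl subrr invr_gt0.
rewrite lnV ?posrE// lerNl opprB => h.
have -> : 2 * (1 + sigma ^+ 2) * (2^-1 * ln y) = (1 + sigma ^+ 2) * ln y by field.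
apply: le_trans (ler_wpM2l _ h); last by rewrite addr_ge0// ltW.
rewrite -(ler_pM2r y0) -mulrA mulrBl mul1r mulVf ?gt_eqF//.
rewrite -(ler_pM2l s2); nra.
Qed.

Definition zseq obs : nat -> Z := fun i => (nth (ord0, 0) obs i).1.
Definition yseq obs : nat -> R := fun i => (nth (ord0, 0) obs i).2.

Lemma zseq_rcons obs o i : (i < size obs)%N -> zseq (rcons obs o) i = zseq obs i.
Proof. by move=> h; rewrite /zseq nth_rcons h. Qed.

Lemma yseq_rcons obs o i : (i < size obs)%N -> yseq (rcons obs o) i = yseq obs i.
Proof. by move=> h; rewrite /yseq nth_rcons h. Qed.

Lemma zseq_last obs o : zseq (rcons obs o) (size obs) = o.1.
Proof. by rewrite /zseq nth_rcons ltnn eqxx. Qed.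

Lemma yseq_last obs o : yseq (rcons obs o) (size obs) = o.2.
Proof. by rewrite /yseq nth_rcons ltnn eqxx. Qed.

Local Notation pc obs := (post_cov sigma k obs).
Local Notation pm obs := (post_mean sigma k obs).

Lemma post_cov_rcons obs o u v : pc (rcons obs o) u v =
  pc obs u v - (pc obs o.1 o.1 + sigma ^+ 2)^-1 * (pc obs u o.1 * pc obs o.1 v).
Proof.
rewrite !post_covE -/(zseq obs) -/(zseq (rcons obs o)) size_rcons -(addn1 (size obs)).
rewrite pcov_step ?pG_unit ?pcov_noise_gt0// zseq_last.
by rewrite (pcov_ext (@zseq_rcons obs o)).
Qed.

Lemma post_mean_rcons obs o u : pm (rcons obs o) u 0 =
  pm obs u 0 + (pc obs o.1 o.1 + sigma ^+ 2)^-1 *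
    (pc obs u o.1 * (o.2 - pm obs o.1 0)).
Proof.
rewrite !post_meanE !post_covE -/(zseq obs) -/(zseq (rcons obs o)) -/(yseq obs)
  -/(yseq (rcons obs o)) size_rcons -(addn1 (size obs)).
rewrite pmean_step ?pG_unit ?pcov_noise_gt0// zseq_last yseq_last.
rewrite (pcov_ext (@zseq_rcons obs o)).
by rewrite (pmean_ext (@zseq_rcons obs o) (@yseq_rcons obs o)).
Qed.

Lemma post_cov_nil : pc [::] = Kmat k.
Proof. by rewrite post_covE /pcov [pX 0 _]thinmx0 !mul0mx subr0. Qed.

Lemma post_mean_nil z : pm [::] z 0 = 0.
Proof. by rewrite post_meanE /pmean [pX 0 _]thinmx0 !mul0mx mxE. Qed.

Lemma post_cov_psd obs : psd (pc obs).
Proof. by rewrite post_covE; case: (pcov_psd_det (size obs) (zseq obs)). Qed.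

Definition info_obs obs : R := info (size obs) (zseq obs).

Lemma info_obs_rcons obs o :
  info_obs (rcons obs o) = info_obs obs + gain (size obs) (zseq obs) o.1.
Proof.
rewrite /info_obs size_rcons -(addn1 (size obs)) info_step zseq_last /gain.
rewrite (pcov_ext (@zseq_rcons obs o)) /info.
by rewrite (infodet_ext (@zseq_rcons obs o)).
Qed.

Lemma post_cov_le_info obs o :
  pc obs o.1 o.1 <= 2 * (1 + sigma ^+ 2) * (info_obs (rcons obs o) - info_obs obs).
Proof. by rewrite info_obs_rcons addrAC subrr add0r; exact: pcov_le_gain. Qed.

Lemma info_obs_nil : info_obs [::] = 0.
Proof. exact: info0. Qed.

End posterior.

(** * Lookahead trees *)

Section leaf_values.
Context {R : realType} (d K zmax : nat).
Local Notation Z := 'I_zmax.+1.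
Local Notation state := {ffun 'I_K -> Z}.
Implicit Types (g : 'I_K -> Z -> R) (s : state) (l : seq 'I_K).

Lemma leaf_valD g g' s l :
  leaf_val (fun j z => g j z + g' j z) s l = leaf_val g s l + leaf_val g' s l.
Proof. by elim: l s => [|j l IH] s /=; rewrite ?addr0// IH addrACA. Qed.

Lemma leaf_valZ (c : R) g s l : leaf_val (fun j z => c * g j z) s l = c * leaf_val g s l.
Proof. by elim: l s => [|j l IH] s /=; rewrite ?mulr0// IH mulrDr. Qed.

Lemma leaf_val_cst (c : R) s l : leaf_val (fun _ _ => c) s l = (size l)%:R * c.
Proof. by elim: l s => [|j l IH] s /=; rewrite ?mul0r// IH -natr1 mulrDl mul1r addrC. Qed.

Lemma eq_leaf_val g g' s l : (forall j z, j \in l -> g j z = g' j z) ->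
  leaf_val g s l = leaf_val g' s l.
Proof.
elim: l s => //= j l IH s e; rewrite e ?mem_head// IH// => i z il.
by rewrite e// inE il orbT.
Qed.

Lemma ler_leaf_val g g' s l : (forall j z, g j z <= g' j z) ->
  leaf_val g s l <= leaf_val g' s l.
Proof. by move=> gg'; elim: l s => //= j l IH s; rewrite lerD. Qed.

Lemma ler_norm_leaf_val g s l : `|leaf_val g s l| <= leaf_val (fun j z => `|g j z|) s l.
Proof.
elim: l s => [|j l IH] s /=; first by rewrite normr0.
by rewrite (le_trans (ler_normD _ _))// lerD.
Qed.

Lemma leavesP l : l \in leaves d K -> uniq l /\ size l = d.
Proof. by case/mapP => t; rewrite mem_enum inE => ut ->; rewrite size_tuple. Qed.

Lemma pick_leafP g s : (d <= K)%N ->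
  pick_leaf d g s \in leaves d K /\
  forall l, l \in leaves d K -> leaf_val g s l <= leaf_val g s (pick_leaf d g s).
Proof.
(* Since [d <= K], the first [d] arms form a leaf, so the default value of [head] is never
   returned. *)
move=> dK; have ne : leaves d K != [::].
  have sz : size (take d (enum 'I_K)) == d by rewrite size_takel// size_enum_ord.
  have : val (Tuple sz) \in leaves d K.
    by apply/map_f; rewrite mem_enum inE take_uniq// enum_uniq.
  by case: (leaves d K).
have [x xl xmax] := argmax_seq (leaf_val g s) ne.
pose q := [seq i <- leaves d K |
    all (fun i' => leaf_val g s i' <= leaf_val g s i) (leaves d K)].
have : x \in q by rewrite mem_filter xmax.
have : pick_leaf d g s = head [::] q by [].
have : {subset q <= [pred i |
    all (fun i' => leaf_val g s i' <= leaf_val g s i) (leaves d K) & i \in leaves d K]}.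
  by move=> i; rewrite mem_filter.
case: q => // i q /(_ i (mem_head _ _)) /andP[/allP h il] -> _.
by split.
Qed.

Lemma MstarE g s : (d <= K)%N -> Mstar d g s = (leaf_val g s (pick_leaf d g s))%:E.
Proof.
move=> dK; have [pl pmax] := pick_leafP g s dK.
apply/eqP; rewrite eq_le; apply/andP; split; last first.
  exact: (le_bigmax_seq _ _ _ (fun i => (leaf_val g s i)%:E) pl).
rewrite /Mstar big_seq; apply: bigmax_le; first by rewrite leNye.
by move=> l ll; rewrite lee_fin pmax.
Qed.

Lemma env_measurable_leaf_val (f : (nat -> R) -> 'I_K -> Z -> R) s l :
  (forall j z, env_measurable (fun u => f u j z)) ->
  env_measurable (fun u => leaf_val (f u) s l).
Proof.
move=> mf; elim: l s => [|j l IH] s d' T phi mphi /=; first exact: measurable_cst.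
by apply: measurable_funD; [exact: mf|exact: IH].
Qed.

Lemma env_measurable_pick d' (U : measurableType d')
    (f : (nat -> R) -> 'I_K -> Z -> R) (G : seq 'I_K -> (nat -> R) -> U) s :
  (forall j z, env_measurable (fun u => f u j z)) ->
  (forall l, env_measurable (G l)) ->
  env_measurable (fun u => G (pick_leaf d (f u) s) u).
Proof.
move=> mf mG d1 T phi mphi; rewrite /pick_leaf.
(* Only the filtered list is generalised; the maximality test keeps ranging over all leaves. The
   choice becomes a finite cascade of measurable conditionals. *)
elim: {2}(leaves d K) => [|l r IH] /=; first exact: mG.
rewrite (_ : (fun _ => _) = (fun t => if all (fun i' => leaf_val (f (phi^~ t)) s i' <=
     leaf_val (f (phi^~ t)) s l) (leaves d K) then G l (phi^~ t) else
   G (head [::] [seq i <- r | all (fun i' => leaf_val (f (phi^~ t)) s i' <=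
     leaf_val (f (phi^~ t)) s i) (leaves d K)]) (phi^~ t))); last first.
  by apply/funext => t; case: all.
apply: measurable_fun_ifT => //; last exact: mG.
elim: (leaves d K) => [|i q IHq] /=; first exact: measurable_cst.
apply: measurable_and => //.
by apply: measurable_fun_ler; apply: env_measurable_leaf_val.
Qed.

End leaf_values.

(** * Posterior sampling *)

Section posterior_sampling.
Context {R : realType} (sigma : R) (d K zmax T : nat).
Variables (k : 'I_zmax.+1 -> 'I_zmax.+1 -> R) (msqrt : forall n, 'M[R]_n -> 'M[R]_n).
Local Notation NZ := zmax.+1.
Local Notation Z := 'I_zmax.+1.
Local Notation state := {ffun 'I_K -> Z}.
Local Notation history := ('I_K -> seq (Z * R)).
Local Notation env := (nat -> R).
Implicit Types (s : state) (hist : history) (l : seq 'I_K) (f : 'I_K -> Z -> R).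

Definition f_noise hist (v : env) (j : 'I_K) (z : Z) : R :=
  \sum_(z' < NZ) msqrt (post_cov sigma k (hist j)) z z' * v (j * NZ + z')%N.

Definition f_mean hist (j : 'I_K) (z : Z) : R := post_mean sigma k (hist j) z 0.

(* Posterior draw of the functions from the seed [v]: both the Thompson sample of a round and,
   with the empty history and [v] the prior seed, the true functions. *)
Definition f_of hist v j z := f_mean hist j z + f_noise hist v j z.

Definition push hist (j : 'I_K) (o : Z * R) : history :=
  fun j' => if j' == j then rcons (hist j') o else hist j'.

Definition ts_base h := (K * NZ + H d T * d + h * (K * NZ))%N.

Fixpoint play_hist f (w : env) s hist l r : history :=
  match l with
  | [::] => hist
  | j :: l' => play_hist f w (step s j)
      (push hist j (s j, f j (s j) + sigma * w (K * NZ + r)%N)) l' r.+1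
  end.

(** The true functions are an argument separate from the seed, so that the induction over rounds can
    replace them by a posterior draw. *)
Fixpoint run_env f (w : env) n h s hist : \bar R :=
  match n with
  | 0 => 0%E
  | n'.+1 =>
      let I := pick_leaf d (f_of hist (fun i => w (ts_base h + i)%N)) s in
      ((leaf_val f s (pick_leaf d f s) - leaf_val f s I)%:E +
       run_env f w n' h.+1 (foldl (@step K zmax) s I) (play_hist f w s hist I (h * d)))%E
  end.

Lemma playE (w : seq R) s hist l r :
  play sigma k msqrt w s hist l r =
  (foldl (@step K zmax) s l, play_hist (ftrue k msqrt w) (nth 0 w) s hist l r).
Proof. by elim: l s hist r => //= j l IH s hist r; rewrite IH. Qed.

Lemma runE (w : seq R) n h s hist : (d <= K)%N ->
  run sigma d T k msqrt w n h s hist = run_env (ftrue k msqrt w) (nth 0 w) n h s hist.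
Proof.
move=> dK; elim: n h s hist => //= n IH h s hist; rewrite IH playE MstarE//=.
have -> : ts_sample sigma d T k msqrt w h hist = f_of hist (fun i => nth 0 w (ts_base h + i)%N).
  apply/funext => j; apply/funext => z; congr (_ + _); apply: eq_bigr => z' _.
  by congr (_ * nth _ _ _); rewrite /ts_idx /ts_base mulnDl mulnA !addnA.
by rewrite EFinB.
Qed.

Lemma ftrueE (w : seq R) : ftrue k msqrt w = f_of (fun=> [::]) (nth 0 w) :> ('I_K -> Z -> R).
Proof.
apply/funext => j; apply/funext => z.
by rewrite /f_of /f_mean post_mean_nil add0r /f_noise post_cov_nil.
Qed.

Lemma run_env_ge0 f w n h s hist : (d <= K)%N -> (0 <= run_env f w n h s hist)%E.
Proof.
move=> dK; elim: n h s hist => //= n IH h s hist; rewrite adde_ge0// lee_fin subr_ge0.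
by apply: (pick_leafP f s dK).2; exact: (pick_leafP _ s dK).1.
Qed.

Lemma play_hist_ext f w w' s hist l r :
  (forall i, (r <= i)%N -> w (K * NZ + i)%N = w' (K * NZ + i)%N) ->
  play_hist f w s hist l r = play_hist f w' s hist l r.
Proof.
elim: l s hist r => //= j l IH s hist r e; rewrite IH ?e// => i ri.
by apply: e; exact: ltnW.
Qed.

(** From round [h] on, the seed is read only in the noise still to come and in Thompson blocks. The
    latter lie after the noise of all [H d T] batches, which explains the bound on [h + n]. *)
Lemma run_env_ext f w w' n h s hist : (h + n <= H d T)%N ->
  (forall i, (K * NZ + h * d <= i)%N -> w i = w' i) ->
  run_env f w n h s hist = run_env f w' n h s hist.
Proof.
elim: n h s hist => //= n IH h s hist hn e.
have -> : (fun i => w (ts_base h + i)%N) = (fun i => w' (ts_base h + i)%N).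
  apply/funext => i; apply: e.
  have : (h * d <= H d T * d)%N.
    by rewrite leq_mul2r (leq_trans (leq_addr _ _) hn) orbT.
  by rewrite /ts_base; move: (H d T * d)%N => x; lia.
set I := pick_leaf _ (f_of _ _) _; congr (_ + _)%E.
rewrite (@play_hist_ext f w w'); last by move=> i hi; apply: e; rewrite leq_add2l.
apply: IH; first by rewrite addSnnS.
by move=> i hi; apply: e; move: hi; rewrite mulSn; lia.
Qed.

(** The observed points are fixed and only the values depend on the seed. Posterior covariances, and
    with them the values of the arbitrary function [msqrt], are then constants. *)
Definition hist_measurable (hist : env -> history) := exists zs : 'I_K -> seq Z,
  (forall u j, map fst (hist u j) = zs j) /\
  forall j i, env_measurable (fun u => (nth (ord0, 0) (hist u j) i).2).

Lemma hist_measurable_cst hist : hist_measurable (fun=> hist).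
Proof.
by exists (fun j => map fst (hist j)); split=> // j i; exact: env_measurable_cst.
Qed.

Lemma hist_measurable_push (hist : env -> history) j z (y : env -> R) :
  hist_measurable hist -> env_measurable y ->
  hist_measurable (fun u => push (hist u) j (z, y u)).
Proof.
move=> [zs [zsE my]] mY.
exists (fun j' => if j' == j then rcons (zs j') z else zs j'); split=> [u j'|j' i].
  by rewrite /push; case: eqP => _; rewrite ?map_rcons zsE.
rewrite /push; case: eqP => _; last exact: my.
rewrite (_ : (fun _ => _) = (fun u => if (i < size (zs j'))%N then (nth (ord0, 0) (hist u j') i).2
   else if i == size (zs j') then y u else 0)).
  case: (i < size (zs j'))%N; first exact: my.
  by case: (i == size (zs j')) => //; exact: env_measurable_cst.
apply/funext => u; rewrite nth_rcons -(zsE u) size_map.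
by case: ifP => // _; case: ifP.
Qed.

Lemma zseq_map (obs : seq (Z * R)) i : (i < size obs)%N -> zseq obs i = nth ord0 (map fst obs) i.
Proof. by move=> h; rewrite (nth_map (ord0, 0)). Qed.

Lemma env_measurable_f_of (hist : env -> history) (v : env -> env) j z :
  hist_measurable hist -> (forall i, env_measurable (fun u => v u i)) ->
  env_measurable (fun u => f_of (hist u) (v u) j z).
Proof.
move=> [zs [zsE my]] mv d' U phi mphi; set m := size (zs j).
have sz u : size (hist u j) = m by rewrite /m -(zsE u) size_map.
have zE u i : (i < m)%N -> zseq (hist u j) i = nth ord0 (zs j) i.
  by move=> im; rewrite zseq_map ?zsE// sz.
apply: measurable_funD.
  rewrite (_ : (fun _ => _) = (fun t => \sum_(b < m)
    (pX k m (nth ord0 (zs j)) *m invmx (pG sigma k m (nth ord0 (zs j)))) z b *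
    (nth (ord0, 0) (hist (phi^~ t) j) b).2)).
    by apply: measurable_sum => b; apply: measurable_funM => //; exact: my.
  apply/funext => t; rewrite /f_mean post_meanE -/(zseq _) -/(yseq _) sz.
  rewrite /pmean (pX_ext k (zE _)) (pG_ext sigma k (zE _)) mxE.
  by apply: eq_bigr => b _; congr (_ * _); rewrite mxE.
apply: measurable_sum => z'; apply: measurable_funM; last exact: mv.
rewrite (_ : (fun _ => _) = (fun=> msqrt (pcov sigma k m (nth ord0 (zs j))) z z')) //.
by apply/funext => t; rewrite post_covE sz (pcov_ext sigma k (zE _)).
Qed.

Lemma hist_measurable_play (f : env -> 'I_K -> Z -> R) (w : env -> env) s
    (hist : env -> history) l r :
  (forall j z, env_measurable (fun u => f u j z)) ->
  (forall i, env_measurable (fun u => w u i)) -> hist_measurable hist ->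
  hist_measurable (fun u => play_hist (f u) (w u) s (hist u) l r).
Proof.
move=> mf mw; elim: l s hist r => //= j l IH s hist r mh; apply: IH.
apply: hist_measurable_push => // d' U phi mphi.
by apply: measurable_funD; [exact: mf|apply: measurable_funM => //; exact: mw].
Qed.

(** The points observed in a round depend on the seed through the chosen leaf; [env_measurable_pick]
    reduces to each fixed leaf, along which they are constant again. *)
Lemma env_measurable_run (f : env -> 'I_K -> Z -> R) (w : env -> env)
    (hist : env -> history) n h s :
  (forall j z, env_measurable (fun u => f u j z)) ->
  (forall i, env_measurable (fun u => w u i)) -> hist_measurable hist ->
  env_measurable (fun u => run_env (f u) (w u) n h s (hist u)).
Proof.
move=> mf mw; elim: n h s hist => [|n IH] h s hist mh /=.
  exact: env_measurable_cst.
apply: (@env_measurable_pick _ d _ _ _ _ (fun u => f_of (hist u) (fun i => w u (ts_base h + i)%N))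
  (fun l u => ((leaf_val (f u) s (pick_leaf d (f u) s) - leaf_val (f u) s l)%:E +
       run_env (f u) (w u) n h.+1 (foldl (@step K zmax) s l) (play_hist (f u) (w u) s (hist u) l (h * d)))%E)).
  by move=> j z; exact: env_measurable_f_of.
move=> l d' U phi mphi; apply: emeasurable_funD; last first.
  have mP := hist_measurable_play s l (h * d) mf mw mh.
  exact: (IH h.+1 (foldl (@step K zmax) s l) _ mP _ _ _ mphi).
apply/measurable_EFinP; apply: measurable_funB; last exact: env_measurable_leaf_val.
apply: (@env_measurable_pick _ d _ _ _ _ f (fun l u => leaf_val (f u) s l)) => // l'.
exact: env_measurable_leaf_val.
Qed.

Hypotheses (sigma_gt0 : 0 < sigma) (dK : (d <= K)%N) (d_gt0 : (0 < d)%N) (kP : kernel_ok k).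
Hypothesis msqrtP : forall n (S : 'M[R]_n), psd S -> msqrt S *m (msqrt S)^T = S.

Local Notation n0 := (K * NZ)%N.
Local Notation P := (iota 0 n0).

Definition block (j : 'I_K) : seq nat := [seq (j * NZ + z)%N | z : 'I_NZ].

Lemma big_block (j : 'I_K) (F : nat -> R) :
  \sum_(i <- block j) F i = \sum_(z < NZ) F (j * NZ + z)%N.
Proof. by rewrite /block big_image. Qed.

Lemma uniq_block j : uniq (block j).
Proof. by rewrite map_inj_uniq ?enum_uniq// => z z' /addnI; exact: val_inj. Qed.

Lemma block_lt (j : 'I_K) (z : 'I_NZ) : (j * NZ + z < n0)%N.
Proof. by have := ltn_ord j; have := ltn_ord z; nia. Qed.

Lemma block_sub j : {subset block j <= P}.
Proof. by move=> i /mapP[z _ ->]; rewrite mem_iota/= add0n block_lt. Qed.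

Definition msqrt_row (hist : history) (j : 'I_K) (a i : nat) : R :=
  msqrt (post_cov sigma k (hist j)) (inord a) (inord (i - j * NZ)).

Lemma f_noiseE hist v j z : f_noise hist v j z = lin (block j) (msqrt_row hist j) v z.
Proof.
rewrite /lin big_block; apply: eq_bigr => z' _.
by rewrite /msqrt_row addKn !inord_val.
Qed.

Lemma gram_msqrt_row hist j (z z' : Z) :
  gram (block j) (msqrt_row hist j) z z' = post_cov sigma k (hist j) z z'.
Proof.
rewrite -[in RHS](msqrtP (post_cov_psd sigma_gt0 kP (hist j))) mxE /gram big_block.
by apply: eq_bigr => i _; rewrite /msqrt_row addKn !inord_val mxE.
Qed.

Definition var hist (j : 'I_K) (z : Z) : R := post_cov sigma k (hist j) z z.

Lemma var_ge0 hist j z : 0 <= var hist j z.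
Proof. by apply: psd_diag_ge0; exact: post_cov_psd. Qed.

Definition unit_noise hist v j z : R := f_noise hist v j z / Num.sqrt (var hist j z).

Lemma f_noise_sqr hist v j z :
  f_noise hist v j z ^+ 2 = var hist j z * unit_noise hist v j z ^+ 2.
Proof.
(* At zero variance the division in [unit_noise] returns 0, and the noise vanishes too because each
   of its coefficients is zero. *)
have [v0|v0] := eqVneq (var hist j z) 0.
  rewrite v0 mul0r f_noiseE; have := v0; rewrite /var -gram_msqrt_row /gram.
  under eq_bigr do rewrite -expr2.
  move=> /eqP; rewrite psumr_eq0 => [/allP g0|i _]; last exact: sqr_ge0.
  rewrite /lin big_seq big1 ?expr0n// => i ib.
  by have := g0 i ib; rewrite /= sqrf_eq0 => /eqP ->; rewrite mul0r.
rewrite /unit_noise expr_div_n sqr_sqrtr ?var_ge0//.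
by rewrite mulrCA divff// mulr1.
Qed.

(** A soft maximum of the squared unit noises over all arms and points. Its first term is the source
    of the logarithm in the regret bound. *)
Definition noise_bound hist v : R :=
  4 * ln n0%:R + 4 / n0%:R * \sum_(p : 'I_K * Z) expR (unit_noise hist v p.1 p.2 ^+ 2 / 4).

Lemma n0_gt0 : (0 < n0)%N.
Proof. by rewrite muln_gt0 (leq_trans d_gt0 dK). Qed.

Lemma ln_n0_ge0 : 0 <= ln n0%:R :> R.
Proof. by rewrite ln_ge0// ler1n n0_gt0. Qed.

(* [y - ln n <= expR (y - ln n) - 1] turns the maximum of the squares into a sum. *)
Lemma unit_noise_le hist v j z : unit_noise hist v j z ^+ 2 <= noise_bound hist v.
Proof.
rewrite /noise_bound; set y := unit_noise _ _ _ _ ^+ 2.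
have n0p : 0 < n0%:R :> R by rewrite ltr0n n0_gt0.
have := expR_ge1Dx (y / 4 - ln n0%:R); rewrite expRB lnK ?posrE// => h.
have : expR (y / 4) <= \sum_(p : 'I_K * Z) expR (unit_noise hist v p.1 p.2 ^+ 2 / 4).
  by rewrite (bigD1 (j, z))//= lerDl sumr_ge0// => p _; exact: expR_ge0.
set S := \sum_p _ => hS.
have : expR (y / 4) / n0%:R <= S / n0%:R by rewrite ler_pM2r ?invr_gt0.
have -> : 4 / n0%:R * S = 4 * (S / n0%:R) by ring.
move: h; move: (expR _ / _) (S / _) (ln _) => a b c; lra.
Qed.

Lemma noise_bound_ge0 hist v : 0 <= noise_bound hist v.
Proof.
rewrite addr_ge0 ?mulr_ge0 ?ln_n0_ge0 ?invr_ge0//.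
by apply: sumr_ge0 => p _; exact: expR_ge0.
Qed.

(* AM-GM: [|f| = s |u| <= c s^2 / 2 + u^2 / (2 c)] *)
Lemma f_noise_le hist v j z c : 0 < c ->
  `|f_noise hist v j z| <= c / 2 * var hist j z + noise_bound hist v / (2 * c).
Proof.
move=> c0; have /(le_trans _) := unit_noise_le hist v j z.
set u := unit_noise _ _ _ _; set V := noise_bound _ _; set x := f_noise _ _ _ _.
move=> /(_ _ (lexx _)) uV; set s2 := var _ _ _.
have s20 : 0 <= s2 by exact: var_ge0.
have xE : x ^+ 2 = s2 * u ^+ 2 by exact: f_noise_sqr.
have V0 : 0 <= V by exact: noise_bound_ge0.
have y0 : 0 <= c / 2 * s2 + V / (2 * c).
  have c0' := ltW c0; apply: addr_ge0; last by apply: divr_ge0 => //; exact: mulr_ge0.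
  by apply: mulr_ge0 => //; exact: divr_ge0.
rewrite -(@ler_pXn2r _ 2)// ?nnegrE// real_normK ?num_real//.
apply: le_trans (_ : s2 * V <= _).
  by rewrite xE ler_wpM2l.
have -> : (c / 2 * s2 + V / (2 * c)) ^+ 2 = s2 * V + (c / 2 * s2 - V / (2 * c)) ^+ 2.
  by field; rewrite gt_eqF.
by rewrite lerDl sqr_ge0.
Qed.

Lemma leaf_noise_le hist v s l c : 0 < c ->
  `|leaf_val (f_noise hist v) s l| <=
  c / 2 * leaf_val (var hist) s l + (size l)%:R * (noise_bound hist v / (2 * c)).
Proof.
move=> c0; apply: le_trans (ler_norm_leaf_val _ _ _) _.
rewrite -(@leaf_val_cst R K zmax _ s) -leaf_valZ -leaf_valD; apply: ler_leaf_val => j z.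
exact: f_noise_le.
Qed.

Lemma f_noise_ext hist v v' : (forall i, (i < n0)%N -> v i = v' i) ->
  f_noise hist v = f_noise hist v'.
Proof.
move=> e; apply/funext => j; apply/funext => z; apply: eq_bigr => z' _.
by rewrite e// block_lt.
Qed.

Lemma f_noiseN hist v : f_noise hist (fun i => - v i) = fun j z => -1 * f_noise hist v j z.
Proof.
apply/funext => j; apply/funext => z; rewrite /f_noise mulr_sumr.
by apply: eq_bigr => z' _; rewrite mulrN mulN1r.
Qed.

Lemma env_measurable_f_noise hist j z : env_measurable (fun v => f_noise hist v j z).
Proof.
move=> d' U phi mphi; apply: measurable_sum => z'.
by apply: measurable_funM => //; exact: mphi.
Qed.

Lemma env_measurable_f_of_cst hist j z : env_measurable (fun v => f_of hist v j z).
Proof.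
apply: env_measurable_f_of; first exact: hist_measurable_cst.
by move=> i; exact: env_measurable_coord.
Qed.

Lemma env_measurable_unit_noise hist j z : env_measurable (fun v => unit_noise hist v j z).
Proof.
move=> d' U phi mphi; apply: measurable_funM => //.
exact: env_measurable_f_noise.
Qed.

Lemma env_measurable_noise_bound hist : env_measurable (fun v => noise_bound hist v).
Proof.
move=> d' U phi mphi; apply: measurable_funD => //; apply: measurable_funM => //.
apply: measurable_sum => p; apply/measurable_EFinP.
exact: (env_measurable_expsq (env_measurable_unit_noise hist p.1 p.2)).
Qed.

(** Equality fails only at points of zero variance, which contribute 1 instead of [sqrt 2]. *)
Lemma Egauss_unit_noise hist j z w :
  (Egauss P (fun v => (expR (unit_noise hist v j z ^+ 2 / 4))%:E) w <= (Num.sqrt 2)%:E)%E.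
Proof.
have s1 : 1 <= Num.sqrt 2 :> R by rewrite -[leLHS]sqrtr1 ler_wsqrtr// ler1n.
have [v0|v0] := eqVneq (var hist j z) 0.
  rewrite (eq_Egauss (g' := fun=> 1%:E)) ?Egauss_cst ?lee_fin//.
  by move=> w' _; rewrite /unit_noise v0 sqrtr0 invr0 mulr0 expr0n mul0r expR0.
have p := perm_sub (iota_uniq 0 n0) (uniq_block j) (@block_sub j).
rewrite (Egauss_perm w _ _ p); first last.
- by move=> v; rewrite lee_fin expR_ge0.
- exact: (env_measurable_expsq (env_measurable_unit_noise hist j z)).
rewrite Egauss_cat (eq_Egauss (g' := fun=> (Num.sqrt 2)%:E)).
  by rewrite Egauss_cst// lee_fin sqrtr_ge0.
move=> w' _.
pose A (a i : nat) := msqrt_row hist j z i / Num.sqrt (var hist j z).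
rewrite -(@Egauss_lin_expsq R (block j) A (j * NZ + (ord0 : 'I_NZ))%N w' (uniq_block j)).
- apply: eq_Egauss => u _; rewrite /unit_noise f_noiseE /lin mulr_suml.
  by congr (expR (_ ^+ 2 / 4))%:E; apply: eq_bigr => i _; rewrite /A mulrAC.
- by apply: map_f; rewrite mem_enum.
- have -> : gram (block j) A 0%N 0%N =
    gram (block j) (msqrt_row hist j) z z / (Num.sqrt (var hist j z)) ^+ 2.
    rewrite /gram mulr_suml; apply: eq_bigr => i _.
    by rewrite /A expr2 invfM; ring.
  by rewrite gram_msqrt_row sqr_sqrtr ?var_ge0// divff.
Qed.

Definition noise_cst : R := 4 * ln n0%:R + 4 * Num.sqrt 2.

Lemma noise_cst_ge0 : 0 <= noise_cst.
Proof. by rewrite addr_ge0 ?mulr_ge0 ?ln_n0_ge0 ?sqrtr_ge0. Qed.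

Lemma Egauss_noise_bound hist w :
  (Egauss P (fun v => (noise_bound hist v)%:E) w <= noise_cst%:E)%E.
Proof.
have n0p : 0 < n0%:R :> R by rewrite ltr0n n0_gt0.
pose e (p : 'I_K * Z) (v : env) : \bar R := (expR (unit_noise hist v p.1 p.2 ^+ 2 / 4))%:E.
have me p : env_measurable (e p) by exact: (env_measurable_expsq (env_measurable_unit_noise hist p.1 p.2)).
have e0 p v : (0 <= e p v)%E by rewrite lee_fin expR_ge0.
have mS : env_measurable (fun v => \sum_(p : 'I_K * Z) e p v)%E.
  by move=> d' U phi mphi; apply: emeasurable_sum => p; exact: me.
have S0 v : (0 <= \sum_(p : 'I_K * Z) e p v)%E by exact: sume_ge0.
have c0 : 0 <= 4 / n0%:R :> R by rewrite divr_ge0.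
rewrite (eq_Egauss (g' := fun v =>
    (4 * ln n0%:R)%:E + (4 / n0%:R)%:E * \sum_(p : 'I_K * Z) e p v)%E); last first.
  by move=> v _; rewrite sumEFin.
rewrite EgaussD; first last.
- by move=> v; rewrite mule_ge0.
- by move=> v; rewrite lee_fin mulr_ge0 ?ln_n0_ge0.
- by move=> d' U phi mphi; apply: measurable_funeM; exact: mS.
- exact: env_measurable_cst.
rewrite Egauss_cst ?lee_fin ?mulr_ge0 ?ln_n0_ge0// EgaussZl// Egauss_sum// EFinD leeD2l//.
have -> : (4 * Num.sqrt 2)%:E = ((4 / n0%:R)%:E * \sum_(p : 'I_K * Z) (Num.sqrt 2)%:E :> \bar R)%E.
  rewrite sumEFin -EFinM sumr_const card_prod !card_ord -(mulr_natr (Num.sqrt 2)); congr EFin.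
  by rewrite [Num.sqrt 2 * _]mulrC mulrA divfK// gt_eqF.
apply: lee_wpmul2l; first by rewrite lee_fin.
by apply: lee_sum => p _; exact: Egauss_unit_noise.
Qed.

Lemma relabel_ts h (g : env -> \bar R) w :
  Egauss (iota (ts_base h) n0) (fun w => g (fun i => w (ts_base h + i)%N)) w =
  Egauss P g (fun i => w (ts_base h + i)%N).
Proof.
rewrite -{1}[ts_base h]addn0 iotaDl.
exact: (@Egauss_relabel R (addn (ts_base h)) P g w (@addnI _)).
Qed.

(** The identity and its opposite have the same Gram matrix. *)
Lemma Egauss_opp (g : env -> \bar R) w : env_measurable g -> (forall v, 0 <= g v)%E ->
  (forall v v', (forall i, (i < n0)%N -> v i = v' i) -> g v = g v') ->
  Egauss P (fun v => g (fun i => - v i)) w = Egauss P g w.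
Proof.
move=> mg g0 gE.
pose A (e : R) (a i : nat) := if a == i then e else 0.
have linE e (u : env) i : (i < n0)%N -> lin P (A e) u i = e * u i.
  move=> in0; rewrite /lin (bigD1_seq i) ?iota_uniq ?mem_iota//= /A eqxx big1 ?addr0//.
  by move=> j; rewrite eq_sym => /negbTE ->; rewrite mul0r.
transitivity (Egauss P (fun v => g (lin P (A (-1)) v)) w).
  by apply: eq_Egauss => v _; apply: gE => i /linE ->; rewrite mulN1r.
rewrite (@eq_gram_Egauss R n0 P _ (A 1) g w (iota_uniq 0 n0))//; last first.
  move=> a b _ _; apply: eq_bigr => i _; rewrite /A.
  by case: eqP => _; case: eqP => _; rewrite ?mulr0 ?mul0r// mulrNN.
by apply: eq_Egauss => v _; apply: gE => i /linE ->; rewrite mul1r.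
Qed.

(* Conditionally on the history, the sample [v] and the truth [u] have the same law and
   the leaf [I v] is independent of [u]; so [E (max f) = E (max sample)] and
   [E f (I v)] is the posterior mean of the leaf [I v].  The even function
   [c0 + c1] only serves to keep all integrands nonnegative. *)
Lemma thompson_round hist h s c w0 : 0 < c ->
  (Egauss (iota (ts_base h) n0) (Egauss P (fun w =>
     (leaf_val (f_of hist w) s (pick_leaf d (f_of hist w) s) -
      leaf_val (f_of hist w) s
        (pick_leaf d (f_of hist (fun i => w (ts_base h + i)%N)) s))%:E)) w0
   <= Egauss (iota (ts_base h) n0) (fun w => (c / 2 * leaf_val (var hist) s
        (pick_leaf d (f_of hist (fun i => w (ts_base h + i)%N)) s))%:E) w0
      + (d%:R / (2 * c) * noise_cst)%:E)%E.
Proof.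
move=> c_gt0; set Ts := iota _ _.
pose ts (w : env) : env := fun i => w (ts_base h + i)%N.
pose I (u : env) := pick_leaf d (f_of hist u) s.
pose m l := leaf_val (f_mean hist) s l.
pose X l (u : env) := leaf_val (f_noise hist u) s l.
pose a (u : env) := leaf_val (f_of hist u) s (I u).
pose c0 := \sum_(l <- leaves d K) `|m l|.
pose c1 (u : env) := \sum_(l <- leaves d K) `|X l u|.
have leafE l u : leaf_val (f_of hist u) s l = m l + X l u by rewrite /m /X -leaf_valD.
have Il u : I u \in leaves d K by exact: (pick_leafP _ s dK).1.
have aE u : a u = m (I u) + X (I u) u by exact: leafE.
have amax u l : l \in leaves d K -> m l + X l u <= a u.
  by move=> ll; rewrite -leafE; exact: (pick_leafP (f_of hist u) s dK).2.
have le_seqsum (f : seq 'I_K -> R) l : (forall l, 0 <= f l) -> l \in leaves d K ->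
    f l <= \sum_(l <- leaves d K) f l.
  by move=> f0 ll; rewrite (big_rem l)//= lerDl sumr_ge0.
have mc0 l : l \in leaves d K -> `|m l| <= c0.
  by move=> ll; apply: (le_seqsum (fun l => `|m l|)).
have Xc1 l u : l \in leaves d K -> `|X l u| <= c1 u.
  by move=> ll; apply: (le_seqsum (fun l => `|X l u|)).
have c0_ge0 : 0 <= c0 by apply: sumr_ge0 => l _; exact: normr_ge0.
have c1_ge0 u : 0 <= c1 u by apply: sumr_ge0 => l _; exact: normr_ge0.
have m_bnd l : l \in leaves d K -> 0 <= c0 + m l /\ c0 + m l <= 2 * c0.
  by move=> /mc0; rewrite ler_norml => /andP[]; lra.
have X_bnd l u : l \in leaves d K -> 0 <= c1 u + X l u /\ 0 <= c1 u - X l u.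
  by move=> /(Xc1 l u); rewrite ler_norml => /andP[]; lra.
have X_ext l v v' : (forall i, (i < n0)%N -> v i = v' i) -> X l v = X l v'.
  by move=> e; rewrite /X (f_noise_ext hist e).
have F_ext v v' : (forall i, (i < n0)%N -> v i = v' i) -> f_of hist v = f_of hist v'.
  move=> e; apply/funext => j; apply/funext => z.
  by rewrite /f_of (f_noise_ext hist e).
have c1_ext v v' : (forall i, (i < n0)%N -> v i = v' i) -> c1 v = c1 v'.
  by move=> e; apply: eq_bigr => l _; rewrite (X_ext l v v').
have a_ext v v' : (forall i, (i < n0)%N -> v i = v' i) -> a v = a v'.
  by move=> e; rewrite /a /I (F_ext v v').
have XN l u : X l (fun i => - u i) = - X l u.
  by rewrite /X f_noiseN leaf_valZ mulN1r.
have mX l : env_measurable (X l).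
  by apply: env_measurable_leaf_val => j z; exact: env_measurable_f_noise.
have mc1 : env_measurable (fun u => (c1 u)%:E).
  move=> d' U phi mphi; apply/measurable_EFinP; apply: measurable_sum => l.
  by apply: measurableT_comp => //; exact: mX.
have mI d' (U : measurableType d') (G : seq 'I_K -> env -> U) :
    (forall l, env_measurable (G l)) -> env_measurable (fun u => G (I u) u).
  move=> mG; apply: (@env_measurable_pick R d _ _ _ _ (f_of hist)) => // j z.
  exact: env_measurable_f_of_cst.
have mXE l : env_measurable (fun u => (c1 u + X l u)%:E).
  move=> d' U phi mphi; apply/measurable_EFinP; apply: measurable_funD.
    by apply/measurable_EFinP; exact: mc1.
  exact: mX.
have ma : env_measurable a.
  apply: (mI _ _ (fun l u => leaf_val (f_of hist u) s l)) => l.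
  by apply: env_measurable_leaf_val => j z; exact: env_measurable_f_of_cst.
have PE : forall (g : env -> \bar R) w w', (forall v v', (forall i, (i < n0)%N -> v i = v' i) -> g v = g v') ->
    Egauss P g w = Egauss P g w'.
  move=> g w w' gE; apply: (@Egauss_indep R P pred0) => // v v' e.
  by apply: gE => i i0; apply: e; rewrite orbF mem_iota.
pose C := Egauss P (fun u => (c1 u)%:E) (fun=> 0).
have CE w : Egauss P (fun u => (c1 u)%:E) w = C.
  by apply: PE => v v' e; rewrite (c1_ext v v').
have C_ge0 : (0 <= C)%E by apply: Egauss_ge0 => u; rewrite lee_fin.
(* [C], and [Q] below, must be finite to be cancelled at the end. Here [c1] is dominated by an
   affine function of [noise_bound], through [leaf_noise_le] at [c = 1]. *)
have C_fin : C \is a fin_num.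
  rewrite ge0_fin_numE//.
  pose b l := 1 / 2 * leaf_val (var hist) s l.
  pose B := \sum_(l <- leaves d K) `|b l|.
  pose B' := \sum_(l <- leaves d K) (size l)%:R / (2 * 1) : R.
  have B0 : 0 <= B by apply: sumr_ge0.
  have B'0 : 0 <= B' by apply: sumr_ge0 => l _; rewrite divr_ge0.
  have nb0 u : (0 <= (noise_bound hist u)%:E)%E by rewrite lee_fin noise_bound_ge0.
  have mnb : env_measurable (fun u => (noise_bound hist u)%:E).
    by move=> d' U phi mphi; apply/measurable_EFinP; exact: env_measurable_noise_bound.
  have mB : env_measurable (fun u => B'%:E * (noise_bound hist u)%:E)%E.
    by move=> d' U phi mphi; apply: measurable_funeM; exact: mnb.
  apply: (@le_lt_trans _ _ (Egauss P (fun u => B%:E + B'%:E * (noise_bound hist u)%:E)%E (fun=> 0))).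
    apply: le_Egauss => //.
    - by move=> d' U phi mphi; apply: emeasurable_funD => //; exact: mB.
    - by move=> u; rewrite adde_ge0// ?mule_ge0// lee_fin.
    move=> u _; rewrite -EFinM -EFinD lee_fin /c1 /B /B' mulr_suml -big_split/=.
    apply: ler_sum => l _; apply: le_trans (leaf_noise_le hist u s l ltr01) _.
    by rewrite lerD// ?ler_norm// mulrA mulrAC.
  have mcst : env_measurable (fun _ : env => B%:E) by exact: env_measurable_cst.
  have B0E (u : env) : (0 <= B%:E :> \bar R)%E by rewrite lee_fin.
  have Bn0 u : (0 <= B'%:E * (noise_bound hist u)%:E)%E by rewrite mule_ge0.
  rewrite (EgaussD P _ mcst mB B0E Bn0).
  rewrite Egauss_cst ?lee_fin// EgaussZl//.
  apply: (@le_lt_trans _ _ (B%:E + B'%:E * noise_cst%:E)%E); last by rewrite -EFinM -EFinD ltry.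
  by rewrite leeD2l// lee_wpmul2l ?lee_fin// Egauss_noise_bound.
(* By symmetry [c1 + X l] and [c1 - X l] have the same expectation, and their sum is [2 * c1]. *)
have centred l w : l \in leaves d K -> Egauss P (fun u => (c1 u + X l u)%:E) w = C.
  move=> ll; have pos u : (0 <= (c1 u + X l u)%:E)%E by rewrite lee_fin; case: (X_bnd l u ll).
  apply: ereal_half_eq => //; first exact: Egauss_ge0.
  rewrite -{1}Egauss_opp//; last by move=> v v' e; rewrite (c1_ext v v')// (X_ext l v v').
  have mN : env_measurable (fun u => (c1 (fun i => - u i) + X l (fun i => - u i))%:E).
    apply: (env_measurable_comp (h := fun u i => - u i) (g := fun u => (c1 u + X l u)%:E)) => // i.
    by move=> d' U phi mphi; exact: measurableT_comp (@oppr_measurable _ _) (mphi i).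
  have c1p u : (0 <= (c1 u)%:E)%E by rewrite lee_fin.
  rewrite -(EgaussD P w mN (mXE l) (fun=> pos _) pos) -(CE w) -(EgaussD P w mc1 mc1 c1p c1p).
  apply: eq_Egauss => u _; rewrite -!EFinD XN; congr EFin.
  have -> : c1 (fun i => - u i) = c1 u by apply: eq_bigr => l' _; rewrite XN normrN.
  ring.
pose S := Egauss P (fun u => (a u + c0 + c1 u)%:E) (fun=> 0).
have abs_ge0 u : 0 <= a u + c0 + c1 u.
  by rewrite aE; case: (X_bnd _ u (Il u)); case: (m_bnd _ (Il u)); lra.
have mabs : env_measurable (fun u => (a u + c0 + c1 u)%:E).
  move=> d' U phi mphi; apply/measurable_EFinP; apply: measurable_funD.
    by apply: measurable_funD => //; exact: ma.
  by apply/measurable_EFinP; exact: mc1.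
have SE w : Egauss P (fun u => (a u + c0 + c1 u)%:E) w = S.
  by apply: PE => v v' e; rewrite (c1_ext v v')// (a_ext v v').
have S_ge0 : (0 <= S)%E by apply: Egauss_ge0 => u; rewrite lee_fin.
(* For a leaf [l] fixed in advance: its expected regret plus its shifted expected value is the
   shifted expected maximum [S]. *)
have tE l w : l \in leaves d K ->
    (Egauss P (fun u => (a u - (m l + X l u))%:E) w + (C + (c0 + m l)%:E) = S)%E.
  move=> ll; have [mp _] := m_bnd l ll.
  have md : env_measurable (fun u => (a u - (m l + X l u))%:E).
    move=> d' U phi mphi; apply/measurable_EFinP; apply: measurable_funB; first exact: ma.
    by apply: measurable_funD => //; exact: mX.
  have dpos u : (0 <= (a u - (m l + X l u))%:E)%E by rewrite lee_fin subr_ge0 amax.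
  have xpos u : (0 <= (c1 u + X l u)%:E)%E by rewrite lee_fin; case: (X_bnd l u ll).
  have mcst : env_measurable (fun _ : env => (c0 + m l)%:E) by exact: env_measurable_cst.
  have cst0 (u : env) : (0 <= (c0 + m l)%:E)%E by rewrite lee_fin.
  have ms : env_measurable (fun u => (c1 u + X l u)%:E + (c0 + m l)%:E)%E.
    by move=> d' U phi mphi; apply: emeasurable_funD => //; exact: mXE.
  have spos u : (0 <= (c1 u + X l u)%:E + (c0 + m l)%:E)%E by rewrite adde_ge0.
  rewrite -(centred l w ll) -(Egauss_cst P w (cst0 w)).
  rewrite -(EgaussD P w (mXE l) mcst xpos cst0) -(EgaussD P w md ms dpos spos).
  rewrite -(SE w); apply: eq_Egauss => u _; rewrite -!EFinD; congr EFin; ring.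
have mshift (g : env -> \bar R) : env_measurable g -> env_measurable (fun w => g (ts w)).
  by move=> mg; apply: (env_measurable_comp (h := ts)) => // i; exact: env_measurable_coord.
have mQ : env_measurable (fun u => (c0 + m (I u))%:E).
  by apply: (mI _ _ (fun l _ => (c0 + m l)%:E)) => l; exact: env_measurable_cst.
pose Q := Egauss Ts (fun w => (c0 + m (I (ts w)))%:E) w0.
have Q_ge0 : (0 <= Q)%E.
  by apply: Egauss_ge0 => u; rewrite lee_fin; case: (m_bnd _ (Il (ts u))).
have Q_fin : Q \is a fin_num.
  rewrite ge0_fin_numE//; apply: (@le_lt_trans _ _ (2 * c0)%:E); last by rewrite ltry.
  rewrite -(@Egauss_cst R Ts (2 * c0)%:E w0) ?lee_fin ?mulr_ge0//.
  apply: le_Egauss.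
  - exact: (mshift _ mQ).
  - exact: env_measurable_cst.
  - by move=> u; rewrite lee_fin; case: (m_bnd _ (Il (ts u))).
  - by move=> u; rewrite lee_fin mulr_ge0.
  - by move=> u _; rewrite lee_fin; case: (m_bnd _ (Il (ts u))).
pose t (w : env) := Egauss P (fun u => (a u - leaf_val (f_of hist u) s (I (ts u)))%:E) w.
have tsP w u : (forall j, j \notin P -> u j = w j) -> ts u = ts w.
  move=> e; apply/funext => i; apply: e; rewrite mem_iota /ts_base -leqNgt /=.
  by rewrite add0n -!addnA leq_addr.
(* The Thompson block lies outside [P], so the sampled leaf is a constant in the integral over
   [P]. *)
have t_eq w : (t w + (C + (c0 + m (I (ts w)))%:E) = S)%E.
  rewrite -(tE (I (ts w)) w (Il _)); congr (_ + _)%E; apply: eq_Egauss => u e.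
  by rewrite leafE (tsP w u e).
have t_ge0 w : (0 <= t w)%E.
  by apply: Egauss_ge0 => u; rewrite lee_fin subr_ge0 leafE amax.
have mt : env_measurable t.
  apply: env_measurable_Egauss => [|u]; last by rewrite lee_fin subr_ge0 leafE amax.
  move=> d' U phi mphi; apply/measurable_EFinP; apply: measurable_funB; first exact: ma.
  apply: (@env_measurable_pick R d _ _ _ _ (fun u => f_of hist (ts u))
    (fun l u => leaf_val (f_of hist u) s l)) => // [j z|l].
    apply: (env_measurable_comp (h := ts) (g := fun v => f_of hist v j z)) => [i|].
      exact: env_measurable_coord.
    exact: env_measurable_f_of_cst.
  by apply: env_measurable_leaf_val => j z; exact: env_measurable_f_of_cst.
have TS : (Egauss Ts t w0 + (C + Q) = S)%E.
  have mcst : env_measurable (fun _ : env => C) by exact: env_measurable_cst.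
  have Qpos u : (0 <= (c0 + m (I (ts u)))%:E)%E.
    by rewrite lee_fin; case: (m_bnd _ (Il (ts u))).
  have ms : env_measurable (fun u => C + (c0 + m (I (ts u)))%:E)%E.
    by move=> d' U phi mphi; apply: emeasurable_funD => //; exact: (mshift _ mQ).
  have spos u : (0 <= C + (c0 + m (I (ts u)))%:E)%E by rewrite adde_ge0.
  rewrite -(Egauss_cst Ts w0 C_ge0) -(EgaussD Ts w0 mcst (mshift _ mQ) (fun=> C_ge0) Qpos).
  rewrite -(EgaussD Ts w0 mt ms t_ge0 spos).
  rewrite -[RHS](@Egauss_cst R Ts S w0)//; apply: eq_Egauss => u _; exact: t_eq.
pose V (u : env) := c / 2 * leaf_val (var hist) s (I u).
pose W (u : env) := d%:R / (2 * c) * noise_bound hist u.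
have V_ge0 u : (0 <= (V u)%:E)%E.
  rewrite lee_fin mulr_ge0// ?divr_ge0// ?(ltW c_gt0)//.
  have := @ler_leaf_val R K zmax (fun _ _ => 0) (var hist) s (I u) (var_ge0 hist).
  by rewrite leaf_val_cst mulr0.
have dc0 : 0 <= d%:R / (2 * c) by rewrite divr_ge0// mulr_ge0// ltW.
have W_ge0 u : (0 <= (W u)%:E)%E by rewrite lee_fin mulr_ge0// noise_bound_ge0.
have mV : env_measurable (fun u => (V u)%:E).
  by apply: (mI _ _ (fun l _ => (c / 2 * leaf_val (var hist) s l)%:E)) => l; exact: env_measurable_cst.
have mnb : env_measurable (fun u => (noise_bound hist u)%:E).
  by move=> d' U phi mphi; apply/measurable_EFinP; exact: env_measurable_noise_bound.
have mW : env_measurable (fun u => (W u)%:E).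
  by move=> d' U phi mphi; apply/measurable_EFinP; apply: measurable_funM => //;
    exact: env_measurable_noise_bound.
(* The leaf maximises the very draw whose noise is measured on it. This is harmless because
   [noise_bound] controls all arms and points simultaneously. *)
have aVW u : a u + c0 + c1 u <= (V u + W u) + ((c0 + m (I u)) + c1 u).
  have := leaf_noise_le hist u s (I u) c_gt0; rewrite (leavesP (Il u)).2.
  have -> : d%:R * (noise_bound hist u / (2 * c)) = W u by rewrite /W; ring.
  rewrite -/(X _ _) -/(V _) => h1; have h2 := le_trans (ler_norm _) h1.
  rewrite aE; lra.
have SVW : (S <= Egauss Ts (fun w => (V (ts w))%:E) w0 + (d%:R / (2 * c) * noise_cst)%:E + (C + Q))%E.
  (* The exchange of truth and sample: [S] depends only on the law of the draw, so its seed may be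
     read from the Thompson block. *)
  have SQ : S = Egauss Ts (fun w => (a (ts w) + c0 + c1 (ts w))%:E) w0.
    by rewrite (relabel_ts h (fun u => (a u + c0 + c1 u)%:E)) SE.
  rewrite SQ.
  have mR : env_measurable (fun u => ((V u)%:E + (W u)%:E) + ((c0 + m (I u))%:E + (c1 u)%:E))%E.
    by move=> d' U phi mphi; apply: emeasurable_funD; apply: emeasurable_funD;
      [exact: mV|exact: mW|exact: mQ|exact: mc1].
  have Qp u : (0 <= (c0 + m (I u))%:E)%E by rewrite lee_fin; case: (m_bnd _ (Il u)).
  have c1p u : (0 <= (c1 u)%:E)%E by rewrite lee_fin.
  apply: le_trans (_ : _ <= Egauss Ts (fun w =>
    ((V (ts w))%:E + (W (ts w))%:E) + ((c0 + m (I (ts w)))%:E + (c1 (ts w))%:E))%E w0)%E _.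
    apply: le_Egauss.
    - exact: (mshift _ mabs).
    - exact: (mshift _ mR).
    - by move=> u; rewrite lee_fin.
    - by move=> u; rewrite !adde_ge0.
    - by move=> u _; rewrite -!EFinD lee_fin.
  have mVW : env_measurable (fun u => (V u)%:E + (W u)%:E)%E.
    by move=> d' U phi mphi; apply: emeasurable_funD; [exact: mV|exact: mW].
  have mQc : env_measurable (fun u => (c0 + m (I u))%:E + (c1 u)%:E)%E.
    by move=> d' U phi mphi; apply: emeasurable_funD; [exact: mQ|exact: mc1].
  have VWp u : (0 <= (V u)%:E + (W u)%:E)%E by rewrite adde_ge0.
  have Qcp u : (0 <= (c0 + m (I u))%:E + (c1 u)%:E)%E by rewrite adde_ge0.
  rewrite (EgaussD Ts w0 (mshift _ mVW) (mshift _ mQc) (fun=> VWp _) (fun=> Qcp _)).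
  rewrite (EgaussD Ts w0 (mshift _ mV) (mshift _ mW) (fun=> V_ge0 _) (fun=> W_ge0 _)).
  rewrite (EgaussD Ts w0 (mshift _ mQ) (mshift _ mc1) (fun=> Qp _) (fun=> c1p _)).
  rewrite (relabel_ts h (fun u => (c1 u)%:E)) CE -/Q (addeC Q) leeD2r// leeD2l//.
  rewrite (relabel_ts h (fun u => (W u)%:E)).
  rewrite (eq_Egauss (g' := fun u => (d%:R / (2 * c))%:E * (noise_bound hist u)%:E)%E); last by [].
  rewrite EgaussZl//; last by move=> u; rewrite lee_fin noise_bound_ge0.
  by rewrite [leRHS]EFinM lee_wpmul2l ?lee_fin// Egauss_noise_bound.
rewrite -(@leeD2rE _ (C + Q)%E); last by rewrite fin_numD C_fin Q_fin.
by rewrite TS.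
Qed.

(** Serves the case in which the logarithm of the final bound is zero. *)
Lemma run_env_single f (w : env) n h s hist : K = 1%N -> run_env f w n h s hist = 0%E.
Proof.
move=> K1; have d1 : d = 1%N by apply/eqP; rewrite eqn_leq d_gt0 andbT -K1.
elim: n h s hist => //= n IH h s hist; rewrite IH adde0; congr EFin.
have [/leavesP[_ +] _] := pick_leafP f s dK.
set u := (X in _ - leaf_val _ _ (pick_leaf _ X _)).
have [/leavesP[_ +] _] := pick_leafP u s dK.
case: (pick_leaf d f s) => [|i []]; case: (pick_leaf d u s) => [|j []]; rewrite ?d1//= => _ _.
have -> : i = j by apply/val_inj => /=; have := ltn_ord i; have := ltn_ord j; lia.
by rewrite subrr.
Qed.

(** * Bayesian update of one arm under the integral sign *)

Lemma f_of_block hist v v' j : (forall i, i \in block j -> v i = v' i) ->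
  forall z, f_of hist v j z = f_of hist v' j z.
Proof.
move=> e z; congr (_ + _); apply: eq_bigr => z' _; congr (_ * _); apply: e.
by apply: map_f; rewrite mem_enum.
Qed.

Lemma block_disj j j' i : j' != j -> i \in block j' -> i \notin block j.
Proof.
move=> jj' /mapP[z _ ->]; apply/mapP => -[z' _ e]; move/negP: jj'; apply.
apply/eqP/val_inj => /=; have := ltn_ord z; have := ltn_ord z'; nia.
Qed.

Lemma post_cov_rcons_y obs z y y' :
  post_cov sigma k (rcons obs (z, y)) = post_cov sigma k (rcons obs (z, y')).
Proof. by apply/matrixP => u v; rewrite !(post_cov_rcons sigma_gt0 kP). Qed.

Lemma push_same hist j o : push hist j o j = rcons (hist j) o.
Proof. by rewrite /push eqxx. Qed.

Lemma push_other hist j j' o : j' != j -> push hist j o j' = hist j'.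
Proof. by rewrite /push => /negbTE ->. Qed.

(* The prior noise [M zeta] of arm [j] and the observation [y] form a Gaussian vector whose
   covariance is also that of the posterior noise [M' zeta] plus the gain times the
   innovation [tau eps]: this is the Bayesian update of arm [j]. *)
Lemma play_law hist j z q (G : ('I_K -> Z -> R) -> R -> env -> \bar R) w :
  (n0 <= q)%N ->
  (forall (f : env -> 'I_K -> Z -> R) (y : env -> R) w0,
    (forall j z, env_measurable (fun u => f u j z)) -> env_measurable y ->
    env_measurable (fun u => G (f u) (y u) w0)) ->
  (forall f y w, (0 <= G f y w)%E) ->
  (forall f y w w', (forall i, i \notin rcons (block j) q -> w i = w' i) ->
    G f y w = G f y w') ->
  let y (w : env) := f_mean hist j z + Num.sqrt (var hist j z + sigma ^+ 2) * w q in
  Egauss (rcons (block j) q) (fun w => G (f_of hist w) (f_of hist w j z + sigma * w q) w) w =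
  Egauss (rcons (block j) q) (fun w => G (f_of (push hist j (z, y w)) w) (y w) w) w.
Proof.
move=> nq mG G0 GE y; set b := rcons _ _; pose tau := Num.sqrt (var hist j z + sigma ^+ 2).
have tau2 : tau ^+ 2 = var hist j z + sigma ^+ 2.
  by rewrite sqr_sqrtr// addr_ge0 ?var_ge0 ?sqr_ge0.
have tau0 : tau != 0.
  by rewrite gt_eqF// sqrtr_gt0 ltr_wpDl ?var_ge0 ?exprn_gt0.
have qb : q \notin block j.
  by apply/negP => /block_sub; rewrite mem_iota /= add0n ltnNge nq.
have ub : uniq b by rewrite rcons_uniq qb uniq_block.
have bq i : i \in block j -> (i == q) = false.
  by move=> ib; apply/negbTE/eqP => e; move: qb; rewrite -e ib.
pose S := post_cov sigma k (hist j).
have Ssym u v : S u v = S v u.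
  by case: (post_cov_psd sigma_gt0 kP (hist j)) => /matrixP /(_ v u); rewrite mxE.
pose hist' := push hist j (z, 0).
pose S' := post_cov sigma k (hist' j).
have S'E u v : S' u v = S u v - (tau ^+ 2)^-1 * (S u z * S z v).
  by rewrite /S' /hist' push_same (post_cov_rcons sigma_gt0 kP) tau2.
(* Rows below [NZ] stand for the values of the function, row [NZ] for the observation at [z]. *)
pose ix (a : nat) : Z := if a == NZ then z else inord a.
pose A (a i : nat) := if i == q then (if a == NZ then sigma else 0)
  else msqrt_row hist j (ix a) i.
(* Column [q] carries the innovation [tau * w q]. The update moves the mean by
   [S (ix a) z / tau ^+ 2] times the innovation, hence the entry [S (ix a) z / tau]. *)
pose B (a i : nat) := if i == q then (if a == NZ then tau else S (ix a) z / tau)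
  else if a == NZ then 0 else msqrt_row hist' j (ix a) i.
have Aq a : A a q = if a == NZ then sigma else 0 by rewrite /A eqxx.
have Bq a : B a q = if a == NZ then tau else S (ix a) z / tau by rewrite /B eqxx.
have linb C (u : env) a : lin b C u a = lin (block j) C u a + C a q * u q.
  by rewrite /lin /b -cats1 big_cat big_seq1.
have gramAB a a' : gram b A a a' = gram b B a a'.
  rewrite /gram /b -cats1 !big_cat !big_seq1 /= /A /B !eqxx.
  rewrite (eq_big_seq (fun i => msqrt_row hist j (ix a) i * msqrt_row hist j (ix a') i)); last first.
    by move=> i ib; rewrite bq.
  rewrite -/(gram _ _ _ _) gram_msqrt_row -/S.
  rewrite (eq_big_seq (fun i => if (a == NZ) || (a' == NZ) then 0 else
    msqrt_row hist' j (ix a) i * msqrt_row hist' j (ix a') i)); last first.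
    by move=> i ib; rewrite bq//; do 2 case: eqP => _; rewrite ?mulr0 ?mul0r.
  have ixN : ix NZ = z by rewrite /ix eqxx.
  case: (eqVneq a NZ) => [->|aN]; case: (eqVneq a' NZ) => [->|aN'] /=; rewrite ?ixN.
  - by rewrite big1// add0r -!expr2 tau2.
  - by rewrite big1// add0r mulr0 addr0 mulrC divfK// Ssym.
  - by rewrite big1// add0r mul0r addr0 divfK.
  - rewrite -/(gram _ _ _ _) gram_msqrt_row -/S' S'E mul0r addr0 (Ssym z).
    by field.
(* The other arms and the remaining seed are frozen at [w]: they use coordinates outside [b], so
   only the Gaussian vector of arm [j] and its observation varies. *)
pose g (v : env) := G (fun j' z' => if j' == j then f_mean hist j z' + v z'
    else f_of hist w j' z') (f_mean hist j z + v NZ) w.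
have mg : env_measurable g.
  apply: (mG (fun v j' z' => if j' == j then f_mean hist j z' + v z' else f_of hist w j' z')
    (fun v => f_mean hist j z + v NZ) w) => [j' z'|].
    case: (j' == j); last exact: env_measurable_cst.
    by move=> d' U phi mphi; apply: measurable_funD => //; exact: mphi.
  by move=> d' U phi mphi; apply: measurable_funD => //; exact: mphi.
have g0 v : (0 <= g v)%E by exact: G0.
have gE v v' : (forall a, (a < NZ.+1)%N -> v a = v' a) -> g v = g v'.
  move=> e; rewrite /g e//; congr G; apply/funext => j'; apply/funext => z'.
  by case: eqP => // _; rewrite e// ltnS ltnW.
have other (w' : env) j' z' : (forall i, i \notin b -> w' i = w i) -> j' != j ->
    f_of hist w' j' z' = f_of hist w j' z'.
  move=> e jj'; apply: f_of_block => i ij'; apply: e.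
  rewrite mem_rcons inE negb_or (block_disj jj' ij') andbT.
  by apply/eqP => iq; have := block_sub ij'; rewrite iq mem_iota /= add0n ltnNge nq.
have ixo (z' : Z) : ix z' = z' by rewrite /ix ltn_eqF// inord_val.
have No (z' : Z) : (z' == NZ :> nat) = false by rewrite ltn_eqF.
transitivity (Egauss b (fun w' => g (lin b A w')) w).
  apply: eq_Egauss => w' e.
  have E z' : f_of hist w' j z' = f_mean hist j z' + lin b A w' z'.
    rewrite /f_of f_noiseE linb Aq No mul0r addr0; congr (_ + _).
    by apply: eq_big_seq => i ib; rewrite /A bq// ixo.
  rewrite /g (GE _ _ _ w)//; congr (G _ _ w).
    apply/funext => j'; apply/funext => z'; case: eqP => [->|/eqP jj'] //.
    exact: other.
  rewrite /f_of f_noiseE linb Aq eqxx addrA; congr (_ + _ + _).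
  by apply: eq_big_seq => i ib; rewrite /A bq// /ix eqxx.
rewrite (@eq_gram_Egauss R NZ.+1 b A B g w ub)//.
apply: eq_Egauss => w' e; apply/esym.
have yE : y w' = f_mean hist j z + lin b B w' NZ.
  rewrite linb Bq eqxx /y; congr (_ + _); rewrite /lin big_seq big1 ?add0r//.
  by move=> i ib; rewrite /B bq// eqxx mul0r.
have E z' : f_of (push hist j (z, y w')) w' j z' = f_mean hist j z' + lin b B w' z'.
  rewrite /f_of /f_mean push_same (post_mean_rcons sigma_gt0 kP) /= -addrA; congr (_ + _).
  rewrite linb Bq No ixo addrC; congr (_ + _).
    rewrite -/(f_noise _ _ _ _) f_noiseE; apply: eq_big_seq => i ib.
    rewrite /B bq// No ixo; congr (_ * _); rewrite /msqrt_row /hist' !push_same.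
    by rewrite (post_cov_rcons_y (hist j) z (y w') 0).
  rewrite -/S -/(var _ _ _) -tau2 /y -/tau -/(f_mean _ _ _) addrAC subrr add0r.
  by field.
rewrite /g (GE _ _ _ w)// yE; congr (G _ _ w).
apply/funext => j'; apply/funext => z'; case: eqP => [->|/eqP jj'].
  by rewrite -yE E.
by rewrite /f_of /f_mean /f_noise !push_other// -/(f_noise hist w' j' z') -/(f_of hist w' j' z') other.
Qed.

(** The coordinates still integrated when [n] rounds remain. The prior block never leaves the list:
    it is reused as the seed of the current posterior draw. *)
Definition Lst n h := P ++ (iota (n0 + h * d) (n * d) ++ iota (ts_base h) (n * n0)).

Lemma uniq_Lst n h r m : (r + m = h * d)%N -> (h + n = H d T)%N ->
  uniq (iota (n0 + r) m ++ Lst n h).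
Proof.
move=> rm hn; have hnd : (h * d + n * d = H d T * d)%N by rewrite -mulnDl hn.
rewrite /Lst /ts_base; move: (h * d)%N (n * d)%N (H d T * d)%N (h * _)%N (n * _)%N rm hnd.
move: n0 => N0 hd nd Hd hn0 nn0 rm hnd; rewrite !cat_uniq !iota_uniq /= andbT.
by repeat (apply/andP; split=> //); apply/hasPn => i; rewrite ?mem_cat !mem_iota; lia.
Qed.

(** * Induction over the rounds with the information as potential *)

Variables (c : R) (Gam : R) (Nmax : nat).
Hypothesis c_gt0 : 0 < c.
Hypothesis GamP : forall obs, (size obs <= Nmax)%N -> info_obs sigma k obs <= Gam.

(** The potential: the information that the arms may still gain. *)
Definition slack hist : R := \sum_j (Gam - info_obs sigma k (hist j)).
Definition round_cst : R := d%:R / (2 * c) * noise_cst.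
Definition var_cst : R := 2 * (1 + sigma ^+ 2).

(* The truth is represented as a posterior draw given the current history; [play_law] shows
   that this representation survives a play. *)
Definition regret_bounded n := forall h s hist w, (h + n = H d T)%N ->
  (forall j, (size (hist j) + n <= Nmax)%N) ->
  (Egauss (Lst n h) (fun w => run_env (f_of hist w) w n h s hist) w <=
   (c / 2 * (var_cst * slack hist) + n%:R * round_cst)%:E)%E.

Lemma slack_push hist j z y :
  var_cst * slack (push hist j (z, y)) <= var_cst * slack hist - var hist j z.
Proof.
have h := post_cov_le_info sigma_gt0 kP (hist j) (z, y).
rewrite /slack (bigD1 j)//= [in leRHS](bigD1 j)//= push_same.
rewrite (eq_bigr (fun i => Gam - info_obs sigma k (hist i))); last first.
  by move=> i ij; rewrite push_other.
rewrite -/var_cst /= in h; rewrite /var; set x := info_obs _ _ (rcons _ _) in h *.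
lra.
Qed.

Lemma env_measurable_play_run (f : env -> 'I_K -> Z -> R) (y : env -> R) (w : env -> env)
    (hist : env -> history) n h s s' j z l r :
  (forall j z, env_measurable (fun u => f u j z)) -> env_measurable y ->
  (forall i, env_measurable (fun u => w u i)) -> hist_measurable hist ->
  env_measurable (fun u => run_env (f u) (w u) n h s
    (play_hist (f u) (w u) s' (push (hist u) j (z, y u)) l r)).
Proof.
move=> mf my mw mh; apply: env_measurable_run => //; apply: hist_measurable_play => //.
exact: hist_measurable_push.
Qed.

(** The size condition reserves one observation of each arm for every later round, and one more for
    the arms still to be played in this leaf. *)
Lemma play_bound n h : regret_bounded n -> (h + n = H d T)%N ->
  forall l s hist r w, uniq l -> (r + size l = h * d)%N ->
  (forall j, (size (hist j) + n + (j \in l) <= Nmax)%N) ->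
  (Egauss (iota (n0 + r) (size l) ++ Lst n h) (fun w => run_env (f_of hist w) w n h
      (foldl (@step K zmax) s l) (play_hist (f_of hist w) w s hist l r)) w <=
   (c / 2 * (var_cst * slack hist - leaf_val (var hist) s l) + n%:R * round_cst)%:E)%E.
Proof.
move=> IH hn; elim=> [|j l IHl] s hist r w ul rl sz.
  by rewrite /= subr0; apply: IH => // j; have := sz j; rewrite addn0.
have [jl ul'] := andP ul.
set q := (n0 + r)%N; set L := iota (n0 + r.+1) (size l) ++ Lst n h.
have -> : iota q (size (j :: l)) ++ Lst n h = q :: L by rewrite /L addnS.
have uqL : uniq (q :: L) by have := uniq_Lst rl hn; rewrite /L addnS.
have sub : {subset rcons (block j) q <= q :: L}.
  move=> i; rewrite mem_rcons !inE => /orP[->//|/block_sub iP].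
  by rewrite /L !mem_cat iP !orbT.
have ub : uniq (rcons (block j) q).
  rewrite rcons_uniq uniq_block andbT; apply/negP => /block_sub.
  by rewrite mem_iota /= add0n ltnNge leq_addr.
have p := perm_sub uqL ub sub.
pose G f (y : R) w := run_env f w n h (foldl (@step K zmax) (step s j) l)
  (play_hist f w (step s j) (push hist j (s j, y)) l r.+1).
pose y (w : env) := f_mean hist j (s j) + Num.sqrt (var hist j (s j) + sigma ^+ 2) * w q.
have my : env_measurable y.
  move=> d' U phi mphi; apply: measurable_funD => //.
  by apply: measurable_funM => //; exact: mphi.
have mw i : env_measurable (fun u : env => u i) by exact: env_measurable_coord.
have mh := hist_measurable_cst hist.
pose Phi (w : env) := G (f_of hist w) (f_of hist w j (s j) + sigma * w q) w.
pose Phi' (w : env) := G (f_of (push hist j (s j, y w)) w) (y w) w.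
have G0 f y' w' : (0 <= G f y' w')%E by exact: run_env_ge0.
have mPhi : env_measurable Phi.
  apply: (env_measurable_play_run (y := fun w => f_of hist w j (s j) + sigma * w q)
    (hist := fun=> hist) (w := id)) => //.
    by move=> j' z; exact: env_measurable_f_of_cst.
  move=> d' U phi mphi; apply: measurable_funD; first exact: env_measurable_f_of_cst.
  by apply: measurable_funM => //; exact: mphi.
have mPhi' : env_measurable Phi'.
  apply: (env_measurable_play_run (f := fun w => f_of (push hist j (s j, y w)) w)
    (hist := fun=> hist) (w := id)) => // j' z.
  by apply: env_measurable_f_of => //; exact: hist_measurable_push.
rewrite -[X in Egauss _ X]/Phi (Egauss_perm w mPhi (fun=> G0 _ _ _) p) Egauss_cat.
have -> : Egauss (rcons (block j) q) Phi = Egauss (rcons (block j) q) Phi'.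
  apply/funext => w'; apply: (@play_law hist j (s j) q G w') => //.
  - exact: leq_addr.
  - move=> f y' w1 mf my'; apply: (env_measurable_play_run (hist := fun=> hist) (w := fun=> w1)) => //.
    by move=> i; exact: env_measurable_cst.
  - move=> f y' w1 w2 e; have e' i : (q < i)%N -> w1 i = w2 i.
      move=> qi; apply: e; rewrite mem_rcons inE negb_or gtn_eqF//=.
      apply/negP => /block_sub; rewrite mem_iota /= add0n; move: qi; rewrite /q; lia.
    rewrite /G (@play_hist_ext f w1 w2); last first.
      by move=> i ri; apply: e'; rewrite ltn_add2l.
    apply: run_env_ext => [|i hi]; first by rewrite hn.
    by apply: e'; apply: leq_trans hi; rewrite ltn_add2l -rl /= -addSnnS leq_addr.
(* Back to the order with [q] outermost: once [w q] is frozen, the observation and the extended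
   history are constants, and the induction hypothesis applies to each of them. *)
rewrite -Egauss_cat -(Egauss_perm w mPhi' (fun=> G0 _ _ _) p).
set bnd := (_ + _)%:E; have qL : q \notin L by case/andP: uqL.
have bound w' : (Egauss L Phi' w' <= bnd)%E.
  pose hist' := push hist j (s j, y w').
  rewrite (eq_Egauss (g' := fun u => run_env (f_of hist' u) u n h (foldl (@step K zmax) (step s j) l)
    (play_hist (f_of hist' u) u (step s j) hist' l r.+1))); last first.
    by move=> u e; rewrite /Phi' /G /hist' /y e.
  apply: le_trans (IHl (step s j) hist' r.+1 w' ul' _ _) _.
  - by rewrite -rl addSnnS.
  - move=> i; have := sz i; rewrite inE; have [->|ij] := eqVneq i j.
      by rewrite (negbTE jl) /hist' push_same size_rcons /=; lia.
    by rewrite /hist' push_other.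
  rewrite lee_fin lerD2r ler_pM2l ?divr_gt0//=.
  (* The arms of the leaf are distinct, so those still to be played keep the variances they had
     before this play. *)
  have -> : leaf_val (var hist') (step s j) l = leaf_val (var hist) (step s j) l.
    apply: eq_leaf_val => i z il; rewrite /var /hist' push_other//.
    by apply/eqP => ij; move: jl; rewrite -ij il.
  by rewrite opprD addrA lerD2r slack_push.
have bnd0 : (0 <= bnd)%E by apply: le_trans (bound w); apply: Egauss_ge0 => ?; exact: G0.
rewrite -(cat1s q) Egauss_cat -[leRHS](Egauss_cst [:: q] w bnd0); apply: le_Egauss => //.
- by apply: env_measurable_Egauss => // ?; exact: G0.
- by move=> u; apply: Egauss_ge0 => ?; exact: G0.
Qed.

(** The order for the future of the run: with the Thompson block outermost the leaf is frozen, as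
    [play_bound] requires. *)
Lemma perm_Lst_ts n h : perm_eq (Lst n.+1 h)
  (iota (ts_base h) n0 ++ (iota (n0 + h * d) d ++ Lst n h.+1)).
Proof.
rewrite /Lst; set ts := iota (ts_base h) n0.
have -> : iota (n0 + h * d) (n.+1 * d) = iota (n0 + h * d) d ++ iota (n0 + h.+1 * d) (n * d).
  by rewrite mulSn iotaD; congr (_ ++ iota _ _); rewrite mulSn; lia.
have -> : iota (ts_base h) (n.+1 * n0) = ts ++ iota (ts_base h.+1) (n * n0).
  rewrite mulSn iotaD; congr (_ ++ iota _ _).
  by rewrite /ts_base mulSn; move: (H d T * d)%N => x; lia.
by apply/permP => a; rewrite !count_cat; lia.
Qed.

(** The order for the regret of the current round: Thompson block, then prior block, innermost, as
    in [thompson_round]. *)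
Lemma perm_Lst_prior n h : perm_eq (Lst n.+1 h)
  ((iota (n0 + h * d) (n.+1 * d) ++ iota (ts_base h.+1) (n * n0)) ++ (iota (ts_base h) n0 ++ P)).
Proof.
rewrite /Lst.
have -> : iota (ts_base h) (n.+1 * n0) = iota (ts_base h) n0 ++ iota (ts_base h.+1) (n * n0).
  rewrite mulSn iotaD; congr (_ ++ iota _ _).
  by rewrite /ts_base mulSn; move: (H d T * d)%N => x; lia.
by apply/permP => a; rewrite !count_cat; lia.
Qed.

Lemma round_cst_ge0 : 0 <= round_cst.
Proof. by rewrite mulr_ge0 ?noise_cst_ge0// divr_ge0// mulr_ge0// ltW. Qed.

Lemma regret_boundedP n : regret_bounded n.
Proof.
elim: n => [|n IH] h s hist w hn sz.
  rewrite (eq_Egauss (g' := fun=> 0%E))// Egauss_cst// lee_fin mul0r addr0.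
  rewrite mulr_ge0 ?divr_ge0 ?(ltW c_gt0)// mulr_ge0//.
    by rewrite mulr_ge0// addr_ge0// sqr_ge0.
  apply: sumr_ge0 => j _; rewrite subr_ge0; apply: GamP.
  by have := sz j; rewrite addn0.
pose ts (w : env) : env := fun i => w (ts_base h + i)%N.
pose I (u : env) := pick_leaf d (f_of hist u) s.
pose V l : R := c / 2 * leaf_val (var hist) s l.
pose B0 : R := c / 2 * (var_cst * slack hist) + n%:R * round_cst.
pose term (w : env) : \bar R := (leaf_val (f_of hist w) s (pick_leaf d (f_of hist w) s)
  - leaf_val (f_of hist w) s (I (ts w)))%:E.
pose rest l (w : env) := run_env (f_of hist w) w n h.+1 (foldl (@step K zmax) s l)
  (play_hist (f_of hist w) w s hist l (h * d)).
have Il u : I u \in leaves d K by exact: (pick_leafP _ s dK).1.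
have term0 u : (0 <= term u)%E.
  by rewrite lee_fin subr_ge0; exact: (pick_leafP (f_of hist u) s dK).2.
have rest0 l u : (0 <= rest l u)%E by exact: run_env_ge0.
have mF j z : env_measurable (fun u => f_of hist u j z) by exact: env_measurable_f_of_cst.
have mFts j z : env_measurable (fun u => f_of hist (ts u) j z).
  by apply: (env_measurable_comp (h := ts) (g := fun u => f_of hist u j z)) => // i;
    exact: env_measurable_coord.
have mI d' (U : measurableType d') (G : seq 'I_K -> env -> U) :
    (forall l, env_measurable (G l)) -> env_measurable (fun u => G (I (ts u)) u).
  by move=> mG; exact: (@env_measurable_pick R d _ _ _ _ (fun u => f_of hist (ts u))).
have mterm : env_measurable term.
  move=> d' U phi mphi; apply/measurable_EFinP; apply: measurable_funB.
    apply: (@env_measurable_pick R d _ _ _ _ (f_of hist) (fun l u => leaf_val (f_of hist u) s l)) => // l.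
    exact: env_measurable_leaf_val.
  apply: (mI _ _ (fun l u => leaf_val (f_of hist u) s l)) => // l.
  exact: env_measurable_leaf_val.
have mrest l : env_measurable (rest l).
  apply: (env_measurable_run (w := id)) => //; first by move=> i; exact: env_measurable_coord.
  apply: hist_measurable_play => //; last exact: hist_measurable_cst.
  by move=> i; exact: env_measurable_coord.
have mrestI : env_measurable (fun u => rest (I (ts u)) u) by exact: (mI _ _ rest).
have hn' : (h.+1 + n = H d T)%N by rewrite addSnnS.
set L2 := iota (n0 + h * d) d ++ Lst n h.+1.
set Ts := iota (ts_base h) n0.
have uL : uniq (Ts ++ L2).
  rewrite -(perm_uniq (perm_Lst_ts n h)).
  by rewrite -[Lst _ _]cat0s; apply: (@uniq_Lst n.+1 h (h * d) 0); rewrite ?addn0.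
have ts_off u v : (forall j, j \notin L2 -> u j = v j) -> (forall i, (i < n0)%N -> ts u i = ts v i).
  move=> e i i0; apply: e; have := uL; rewrite cat_uniq => /and3P[_ /hasPn dis _].
  by apply/negP => /dis /negP; apply; rewrite /= mem_iota leq_addr ltn_add2l.
have I_ext u v : (forall i, (i < n0)%N -> u i = v i) -> I u = I v.
  move=> e; rewrite /I; congr pick_leaf; apply/funext => j; apply/funext => z.
  by rewrite /f_of (f_noise_ext hist e).
have restB u : (Egauss L2 (fun v => rest (I (ts v)) v) u <= (B0 - V (I (ts u)))%:E)%E.
  rewrite (eq_Egauss (g' := rest (I (ts u)))); last first.
    by move=> v e; rewrite (I_ext (ts v) (ts u))//; exact: ts_off.
  have [ul sl] := leavesP (Il (ts u)).
  have := @play_bound n h.+1 IH hn' (I (ts u)) s hist (h * d)%N u ul.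
  rewrite sl; move=> /(_ _ _)/le_trans; apply.
  - by rewrite mulSn addnC.
  - by move=> j; apply: leq_trans (sz j); case: (_ \in _); rewrite addnS ?addn1// addn0.
  - by rewrite lee_fin /B0 /V mulrBr; lra.
have BV0 u : (0 <= (B0 - V (I (ts u)))%:E)%E.
  by apply: le_trans (restB u); apply: Egauss_ge0 => v; exact: rest0.
have V0 u : (0 <= (V (I (ts u)))%:E)%E.
  rewrite lee_fin mulr_ge0// ?divr_ge0// ?(ltW c_gt0)//.
  have := @ler_leaf_val R K zmax (fun _ _ => 0) (var hist) s (I (ts u)) (var_ge0 hist).
  by rewrite leaf_val_cst mulr0.
have mV : env_measurable (fun u => (V (I (ts u)))%:E).
  by apply: (mI _ _ (fun l _ => (V l)%:E)) => l; exact: env_measurable_cst.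
have mBV : env_measurable (fun u => (B0 - V (I (ts u)))%:E).
  by apply: (mI _ _ (fun l _ => (B0 - V l)%:E)) => l; exact: env_measurable_cst.
rewrite -[X in Egauss _ X]/(fun u => term u + rest (I (ts u)) u)%E.
rewrite (EgaussD _ w mterm mrestI term0 (fun=> rest0 _ _)).
pose VT := Egauss Ts (fun u => (V (I (ts u)))%:E) w.
have VTE u : Egauss Ts (fun u => (V (I (ts u)))%:E) u = VT.
  apply: (@Egauss_indep R Ts pred0) => // v v' e; rewrite (I_ext (ts v) (ts v'))// => i i0.
  by apply: e; rewrite orbF mem_iota leq_addr ltn_add2l.
have VT0 : (0 <= VT)%E by exact: Egauss_ge0.
have rc0 : (0 <= round_cst%:E)%E by rewrite lee_fin round_cst_ge0.
have termB : (Egauss (Lst n.+1 h) term w <= VT + round_cst%:E)%E.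
  rewrite (Egauss_perm w mterm term0 (perm_Lst_prior n h)) Egauss_cat.
  set J := iota _ _ ++ iota _ _.
  rewrite -[leRHS](Egauss_cst J w (adde_ge0 VT0 rc0)); apply: le_Egauss.
  - exact: env_measurable_Egauss.
  - exact: env_measurable_cst.
  - by move=> u; exact: Egauss_ge0.
  - by move=> u; exact: adde_ge0.
  - by move=> u _; rewrite Egauss_cat -(VTE u); exact: thompson_round.
have restTs : (Egauss (Lst n.+1 h) (fun u => rest (I (ts u)) u) w <=
    Egauss Ts (fun u => (B0 - V (I (ts u)))%:E) w)%E.
  rewrite (Egauss_perm w mrestI (fun=> rest0 _ _) (perm_Lst_ts n h)) Egauss_cat; apply: le_Egauss => //.
  - exact: env_measurable_Egauss.
  - by move=> u; apply: Egauss_ge0 => v; exact: rest0.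
(* The expected variance paid in the current round is exactly what the bound on the future saves, so
   the two random terms add up to the constant [B0]. *)
apply: le_trans (leeD termB restTs) _.
rewrite addeAC -(EgaussD Ts w mV mBV V0 BV0).
rewrite (eq_Egauss (g' := fun=> B0%:E)); last first.
  by move=> u _; rewrite -EFinD; congr EFin; ring.
rewrite Egauss_cst; last by have := adde_ge0 (V0 w) (BV0 w); rewrite -EFinD addrC subrK.
by rewrite -EFinD lee_fin /B0 -[n.+1%:R]natr1 mulrDl mul1r addrA.
Qed.

Lemma expected_regretE s0 : expected_regret sigma d K zmax T k s0 msqrt =
  Egauss (Lst (H d T) 0) (fun w => run_env (f_of (fun=> [::]) w) w (H d T) 0 s0 (fun=> [::])) (fun=> 0).
Proof.
have -> : Lst (H d T) 0 = iota 0 (seed_size d K zmax T).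
  rewrite /Lst /ts_base !mul0n !addn0 /seed_size -addnA iotaD add0n iotaD mulnA.
  by congr (_ ++ (_ ++ iota _ _)); rewrite addnA.
rewrite -gauss_expectE; congr gauss_expect; apply/funext => w.
by rewrite /regret runE// ftrueE.
Qed.

Lemma expected_regret_le s0 : (H d T <= Nmax)%N ->
  (expected_regret sigma d K zmax T k s0 msqrt <=
   (c / 2 * (var_cst * (K%:R * Gam)) + (H d T)%:R * round_cst)%:E)%E.
Proof.
move=> HN; rewrite expected_regretE.
have B := @regret_boundedP (H d T) 0%N s0 (fun=> [::]) (fun=> 0) (add0n _).
apply: le_trans (B _) _ => //.
rewrite lee_fin lerD2r /slack; under eq_bigr do rewrite info_obs_nil subr0.
by rewrite sumr_const card_ord -(mulr_natl Gam).
Qed.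

End posterior_sampling.

(** * Choice of the constants and optimisation over [c] *)

Theorem theorem3 (R : realType) (sigma : R) (d : nat) :
  0 < sigma -> (0 < d)%N ->
  exists C : R, 0 < C /\
    forall (K zmax T : nat) (k : 'I_zmax.+1 -> 'I_zmax.+1 -> R)
           (s0 : {ffun 'I_K -> 'I_zmax.+1})
           (msqrt : forall n, 'M[R]_n -> 'M[R]_n),
      (d <= K)%N ->
      (K * zmax.+1 <= T)%N ->
      kernel_ok k ->
      (forall n (S : 'M[R]_n), psd S -> msqrt n S *m (msqrt n S)^T = S) ->
      (expected_regret sigma d K zmax T k s0 msqrt <=
       (C * Num.sqrt (K%:R * T%:R * gammaN sigma k T
                      * ln (T * K * zmax.+1)%:R))%:E)%E.
Proof.
move=> sigma0 d0.
have ln2 : 0 < ln 2 :> R by rewrite ln_gt0// ltr1n.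
(* Chosen so that [noise_cst <= kappa * Lg] as soon as [Lg >= ln 2]: the additive [4 * sqrt 2] is
   traded for a multiple of the logarithm. *)
pose kappa : R := 4 + 4 * Num.sqrt 2 / ln 2.
have kappa0 : 0 < kappa by rewrite ltr_wpDr// divr_ge0 ?ltW// mulr_gt0// sqrtr_gt0.
have s1 : 0 < 1 + sigma ^+ 2 by rewrite addr_gt0// exprn_gt0.
exists (2 * Num.sqrt (2 * (1 + sigma ^+ 2) * kappa)); split.
  by rewrite mulr_gt0// sqrtr_gt0 !mulr_gt0.
move=> K zmax T k s0 msqrt dK KT kP mP.
have K0 : (0 < K)%N by exact: leq_trans d0 dK.
have T0 : (0 < T)%N by apply: leq_trans KT; rewrite muln_gt0 K0.
have dT : (d <= T)%N by apply: leq_trans KT; nia.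
(* Here the logarithm is zero and absorbs nothing, but there is a single arm and the regret
   vanishes. *)
have [N1|N1] := eqVneq (T * K * zmax.+1)%N 1%N.
  have K1 : K = 1%N by nia.
  rewrite N1 ln1 mulr0 sqrtr0 mulr0 expected_regretE//.
  by rewrite (eq_Egauss (g' := fun=> 0%E)) ?Egauss_cst// => w _; rewrite (run_env_single _ _ _ sigma0 dK d0).
have N2 : (2 <= T * K * zmax.+1)%N by have : (0 < T * K * zmax.+1)%N; nia.
set Lg : R := ln _; set g := gammaN _ _ _.
have Lg2 : ln 2 <= Lg by rewrite ler_ln ?posrE ?ltr0n ?ler_nat//; lia.
have g0 : 0 <= g by exact: gammaN_ge0.
have n0 : (0 < K * zmax.+1)%N by rewrite muln_gt0 K0.
have ncst : noise_cst K zmax <= kappa * Lg :> R.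
  have l1 : ln (K * zmax.+1)%:R <= Lg.
    rewrite ler_ln ?posrE ?ltr0n ?ler_nat//; last exact: leq_trans N2.
    by rewrite -mulnA leq_pmull.
  have l2 : 4 * Num.sqrt 2 <= 4 * Num.sqrt 2 / ln 2 * Lg.
    rewrite -mulrA ler_peMr ?mulr_ge0 ?sqrtr_ge0// mulrC ler_pdivlMr// mul1r//.
  have -> : kappa * Lg = 4 * Lg + 4 * Num.sqrt 2 / ln 2 * Lg by rewrite /kappa; ring.
  by apply: lerD l2; rewrite ler_pM2l.
have Lg0 : 0 < Lg by exact: lt_le_trans Lg2.
(* [A] and [B] are the coefficients of [c] and [1 / c]; the 2 in the information bound [2 * g]
   cancels the one half in front of [c]. *)
pose A : R := 2 * (1 + sigma ^+ 2) * K%:R * g.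
pose B : R := T%:R * (kappa * Lg).
have A0 : 0 <= A by rewrite !mulr_ge0// ltW.
have B0 : 0 < B by rewrite !mulr_gt0// ltr0n.
have -> : 2 * Num.sqrt (2 * (1 + sigma ^+ 2) * kappa) * Num.sqrt (K%:R * T%:R * g * Lg) =
    2 * Num.sqrt (A * B).
  rewrite -mulrA -sqrtrM ?mulr_ge0 ?(ltW s1) ?(ltW kappa0)//.
  by congr (_ * Num.sqrt _); rewrite /A /B; ring.
apply: le_inf_balance => // c c0.
have HT : (H d T <= T.+1)%N by rewrite /H ltnS leq_div.
have GP obs : (size obs <= T.+1)%N -> info_obs sigma k obs <= 2 * g.
  exact: info_le_2gammaN.
apply: le_trans (expected_regret_le sigma0 dK d0 kP mP c0 GP s0 HT) _.
rewrite lee_fin lerD//.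
  by rewrite /A /var_cst le_eqVlt; apply/orP; left; apply/eqP; field.
(* The extra batch costs at most [d <= T] rounds; the resulting 2 cancels the one in [2 * c]. *)
have Hd : (H d T * d <= 2 * T)%N.
  by rewrite /H mulSn mul2n -addnn leq_add// leq_trunc_div.
rewrite /round_cst /B.
have -> : (H d T)%:R * (d%:R / (2 * c) * noise_cst K zmax) =
    (H d T * d)%:R * noise_cst K zmax / (2 * c) :> R by rewrite natrM; ring.
have -> : T%:R * (kappa * Lg) / c = (2 * T)%:R * (kappa * Lg) / (2 * c).
  by rewrite natrM; field; rewrite gt_eqF.
rewrite ler_pM2r ?invr_gt0 ?mulr_gt0//.
by apply: ler_pM; rewrite ?ler_nat ?(noise_cst_ge0 _ dK).
Qed.
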